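(* Let $p$ be an odd prime and let $\varepsilon>0$. Then there is a constant $C_{p,\varepsilon}$ (depending only on $p$ and $\varepsilon$) such that, for every $n\ge 1$, $$a(3\text{-}\mathrm{AP},\mathbb{F}_p^n)\le C_{p,\varepsilon}\,n^{1+\varepsilon}\,p^{n/2}.$$ In particular, for every fixed odd prime $p$, $$a(3\text{-}\mathrm{AP},\mathbb{F}_p^n)=p^{n/2+o(n)}\qquad (n\to\infty).$$
   Context: $\mathbb{F}_p^n$ is regarded as an additive abelian group. For an abelian group $G$ written additively, a $3$-term arithmetic progression ($3$-AP) is a set of three distinct elements of the form $g,\ g+d,\ g+2d$ with $g,d\in G$. A subset of $G$ is $3$-AP-free if it contains no $3$-AP; it is complete $3$-AP-free if it is $3$-AP-free and maximal (with respect to inclusion among subsets of $G$) with this property. $a(3\text{-}\mathrm{AP},G)$ denotes the minimum size of a complete $3$-AP-free subset of $G$. *)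

(* Defs.v *)
From HB Require Import structures.
From mathcomp Require Import all_boot all_order all_algebra.
Set Implicit Arguments.
Unset Strict Implicit.
Unset Printing Implicit Defensive.
Import GRing.Theory.
Local Open Scope ring_scope.

Definition is_3AP (G : finZmodType) (A : {set G}) : bool :=
  [exists g : G, exists d : G,
     uniq [:: g; g + d; g + d *+ 2] && (A == [set g; g + d; g + d *+ 2])].

Definition AP3_free (G : finZmodType) (S : {set G}) : bool :=
  [forall A : {set G}, is_3AP A ==> ~~ (A \subset S)].

Definition complete_AP3_free (G : finZmodType) (S : {set G}) : bool :=
  maxset (@AP3_free G) S.

Lemma AP3_free0 (G : finZmodType) : AP3_free (set0 : {set G}).
Proof.
apply/forallP => A; apply/implyP => /existsP[g /existsP[d /andP[_ /eqP->]]].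
by apply/subsetPn; exists g; rewrite !inE ?eqxx.
Qed.

Lemma complete_AP3_free_exists (G : finZmodType) :
  exists m : nat, [exists S : {set G}, complete_AP3_free S && (#|S| == m)].
Proof.
have [S Smax _] := maxset_exists (AP3_free0 G).
by exists #|S|; apply/existsP; exists S; rewrite eqxx andbT.
Qed.

Definition a_3AP (G : finZmodType) : nat :=
  ex_minn (complete_AP3_free_exists G).

(* Main.v *)
Require Import Defs.
From HB Require Import structures.
From mathcomp Require Import all_boot all_order all_fingroup all_solvable all_algebra all_field.
From mathcomp Require Import ring lra zify.
Set Implicit Arguments.
Unset Strict Implicit.
Unset Printing Implicit Defensive.
Import Order.TTheory GRing.Theory Num.Theory.
Local Open Scope ring_scope.

(** A set is complete exactly when it is 3-AP-free and every point x is obtained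
from two of its points y, z as their midpoint (x + x = y + z) or as the
continuation of the progression z, y, x (x + z = y + y).  Since x is
determined by (y, z) and the kind of the combination, a complete set S
satisfies p ^ n <= 2 |S| ^ 2, which is the lower bound.

For the upper bound, complete sets with O(n p^(n/2)) elements are built.  Let
K be a field with q elements, L an extension of K of odd degree with Q
elements, eta a nonsquare of K, N(x, s) = x^2 - eta s^2 (a form that vanishes
only at 0), W a complete set of a small group Phi, and omega : L -> K any
function.  In K^3 * Phi * L^2 consider the points
  (x, s, N(x, s) + omega(a), w, x a, x a^2),   x <> 0,  w in W,  a in L.
For a fixed a they lie on a copy of K^3 * Phi.  If x1 + x3 = 2 x2 and the
weighted means of a and of a^2 agree, then
x1 x3 (a1 - a3)^2 = 0 (lemma weighted_variance), so a progression stays in one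
copy, where the form N and then the set W rule it out; this holds for every
omega.  Conversely a point (x, s, y, w, u, v) with x v <> u^2 has about q / 2
ways of being a weighted mean in the coordinates x, u, v (lemma pair_options), because
both square classes of L are represented by K, the degree being odd; these
ways use disjoint pairs (a1, a2), and each of them also produces the coordinate
y for at least half of the values omega(a2), since half of K are squares.
Hence a random omega misses a given point with probability at most
2^(-(q-3)/2), and once q >= 2 p n + 7 some omega misses none
(lemma reaching_heights).  The points with x v = u^2 are reached inside one
copy, because N takes every value, except when x = u = 0 and v <> 0.  These last points lie in a
much smaller group, where a complete set with fewer than Q elements (a
paraboloid over a large field, translated to avoid v = 0) is added.

The resulting set has at most 2 q^2 Q |W| elements, and q^3 Q^2 |Phi| = p^n:
  a(n)^2 <= 4 q p^n a(j)^2 / p^j   for Phi of dimension j = O(log n), q = O(n).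
With the trivial a(j) <= p^j this gives a(n)^2 <= C (n+1)^5 p^n; using this for
a(j), which is now p^(j/2) up to a power of log n, gives a(n)^2 <= C n^2 p^n. *)

(** * Complete sets and their transport *)

(** The two ways in which x completes a progression with y and z: x is their
midpoint (b = false), or y is the midpoint of x and z (b = true). *)
Definition combines (G : zmodType) (b : bool) (x y z : G) : bool :=
  if b then x + z == y + y else x + x == y + z.

Definition spans (G : finZmodType) (S : {set G}) : Prop :=
  forall x : G, exists b y z, [/\ y \in S, z \in S & combines b x y z].

Lemma combinesxx (G : zmodType) b (x : G) : combines b x x x.
Proof. by case: b; rewrite /combines. Qed.

(** Progressions as solutions of x + z = y + y.  A solution with x <> z has three
distinct entries, whatever the characteristic. *)
Lemma AP3_freeP (G : finZmodType) (S : {set G}) :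
  reflect (forall x y z, x \in S -> y \in S -> z \in S -> x + z = y + y -> x = z)
          (AP3_free S).
Proof.
apply: (iffP forallP) => [freeS x y z xS yS zS xzy | freeS A].
  apply/eqP; apply: contraT => x_neq_z.
  have x_neq_y : x != y.
    by apply: contraNneq x_neq_z => xy; move: xzy; rewrite xy => /addrI->.
  have y_neq_z : y != z.
    by apply: contraNneq x_neq_z => yz; move: xzy; rewrite yz => /addIr->.
  have dy : x + (y - x) = y by rewrite addrC subrK.
  have dz : x + (y - x) *+ 2 = z.
    by rewrite mulr2n addrA dy addrA -xzy [x + z]addrC addrK.
  have := freeS [set x; y; z]; rewrite /is_3AP.
  have -> /= : [exists g : G, exists d : G, uniq [:: g; g + d; g + d *+ 2] &&
       ([set x; y; z] == [set g; g + d; g + d *+ 2])].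
    apply/existsP; exists x; apply/existsP; exists (y - x).
    by rewrite dy dz /= !inE negb_or x_neq_y x_neq_z y_neq_z eqxx.
  case/subsetPn=> t; rewrite !inE => /orP[/orP[]|] /eqP->; by rewrite ?xS ?yS ?zS.
apply/implyP => /existsP[g /existsP[d /andP[Ud /eqP defA]]].
apply/negP => /subsetP AS; move: Ud => /= /andP[]; rewrite !inE negb_or => /andP[_].
suff <- : g = g + d *+ 2 by rewrite eqxx.
have [gA gdA gddA] : [/\ g \in A, g + d \in A & g + d *+ 2 \in A].
  by rewrite defA !inE !eqxx !orbT.
apply: (freeS g (g + d)); rewrite ?AS //.
by rewrite mulr2n [RHS]addrACA -addrA.
Qed.

Section NoTwoTorsion.

Variable G : finZmodType.
Hypothesis no2 : forall x : G, x + x = 0 -> x = 0.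

Lemma double_inj (x y : G) : x + x = y + y -> x = y.
Proof.
move=> xy; apply/eqP; rewrite -subr_eq0; apply/eqP/no2.
by rewrite addrACA -opprD xy subrr.
Qed.

(** Maximality is a covering property: a point outside S that could not be
added must form a progression with two points of S.  Points of S are trivially
combinations of themselves, which removes the case distinction from spans. *)
Lemma complete_AP3_freeP (S : {set G}) :
  reflect (AP3_free S /\ spans S) (complete_AP3_free S).
Proof.
apply: (iffP maxsetP) => [[freeS maxS] | [freeS spanS]]; split=> //.
  move=> x; have [xS | xNS] := boolP (x \in S).
    by exists false, x, x; rewrite combinesxx.
  have [/existsP[b /existsP[y /existsP[z /and3P[]]]] | none] :=
      boolP [exists b, exists y, exists z, [&& y \in S, z \in S & combines b x y z]].
    by exists b, y, z.
  case/negP: xNS; rewrite -(maxS (x |: S)) ?setU11 ?subsetUr //.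
  have {}none b y z : y \in S -> z \in S -> combines b x y z = false.
    move=> yS zS; apply: contraNF none => byz; apply/existsP; exists b.
    by apply/existsP; exists y; apply/existsP; exists z; rewrite yS zS.
  move/AP3_freeP: freeS => freeS; apply/AP3_freeP => t y z.
  rewrite !inE => /orP[/eqP-> | tS] /orP[/eqP-> | yS] /orP[/eqP-> | zS] // tzy.
  - by move/addrI: tzy.
  - by have := none true y z yS zS; rewrite /combines tzy eqxx.
  - by move/addIr: tzy.
  - by have := none false t z tS zS; rewrite /combines tzy eqxx.
  - by have := none true y t yS tS; rewrite /combines addrC tzy eqxx.
  - exact: (freeS t y z).
move=> T freeT ST; apply/eqP; rewrite eqEsubset ST andbT; apply/subsetP => x xT.
have [b [y [z [yS zS]]]] := spanS x; move/AP3_freeP: freeT => freeT.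
have yT := subsetP ST y yS; have zT := subsetP ST z zS.
case: b; rewrite /combines => /eqP xyz; first by rewrite (freeT x y z).
have yz : y = z by apply: (freeT y x z).
by rewrite (double_inj (x := x) (y := y)) // xyz -yz.
Qed.

Lemma combines_inj b (x1 x2 y z : G) :
  combines b x1 y z -> combines b x2 y z -> x1 = x2.
Proof.
by case: b => /eqP e1 /eqP e2; [apply: (@addIr _ z) | apply: double_inj]; rewrite e1.
Qed.

(** The lower bound: the kind of the combination and the pair (y, z) determine x. *)
Lemma card_le_spans (S : {set G}) : spans S -> (#|G| <= 2 * #|S| ^ 2)%N.
Proof.
move=> spanS.
have ex x : exists t : bool * (G * G),
    (t.2 \in setX S S) && combines t.1 x t.2.1 t.2.2.
  by have [b [y [z [yS zS c]]]] := spanS x; exists (b, (y, z)); rewrite /= in_setX yS zS.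
pose h x := xchoose (ex x).
have h_inj : injective h.
  move=> x1 x2 e; have /andP[_ c1] := xchooseP (ex x1).
  have /andP[_] := xchooseP (ex x2); rewrite -/(h x2) -e; exact: combines_inj.
rewrite -cardsT -(card_imset _ h_inj) -mulnn -cardsX -card_bool -cardsT -cardsX.
apply: subset_leq_card; apply/subsetP => _ /imsetP[x _ ->].
have := xchooseP (ex x); rewrite -/(h x); case: (h x) => b [y z] /= /andP[yzS _].
by rewrite in_setX in_setT.
Qed.

End NoTwoTorsion.

Section SmallestComplete.

Variable G : finZmodType.

Lemma a_3AP_le (S : {set G}) : complete_AP3_free S -> (a_3AP G <= #|S|)%N.
Proof.
rewrite /a_3AP; case: ex_minnP => m _ minm complS; apply: minm.
by apply/existsP; exists S; rewrite complS eqxx.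
Qed.

Lemma a_3AP_witness : exists2 S : {set G}, complete_AP3_free S & #|S| = a_3AP G.
Proof.
rewrite /a_3AP; case: ex_minnP => m /existsP[S /andP[complS /eqP cardS]] _.
by exists S.
Qed.

End SmallestComplete.

Section Transport.

Variables G H : finZmodType.
Hypotheses (no2G : forall x : G, x + x = 0 -> x = 0)
           (no2H : forall x : H, x + x = 0 -> x = 0).
Variable f : G -> H.
Hypothesis fD : {morph f : x y / x + y}.

Lemma combines_morph b x y z : combines b x y z -> combines b (f x) (f y) (f z).
Proof. by case: b => /eqP e; rewrite /combines -!fD e. Qed.

Hypothesis f_bij : bijective f.

Lemma complete_AP3_free_imset (S : {set G}) :
  complete_AP3_free S -> complete_AP3_free (f @: S).
Proof.
have f_inj := bij_inj f_bij.
case/(complete_AP3_freeP no2G) => /AP3_freeP freeS spanS.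
apply/(complete_AP3_freeP no2H); split.
  apply/AP3_freeP => _ _ _ /imsetP[x xS ->] /imsetP[y yS ->] /imsetP[z zS ->].
  by rewrite -!fD => /f_inj xzy; rewrite (freeS x y z).
have [g gK fK] := f_bij => x'; rewrite -(fK x').
have [b [y [z [yS zS c]]]] := spanS (g x').
by exists b, (f y), (f z); rewrite !imset_f ?combines_morph.
Qed.

End Transport.

Lemma complete_AP3_free_translate (G : finZmodType) (v : G) (S : {set G}) :
    (forall x : G, x + x = 0 -> x = 0) ->
  complete_AP3_free S -> complete_AP3_free [set x + v | x in S].
Proof.
move=> no2 /(complete_AP3_freeP no2)[/AP3_freeP freeS spanS].
apply/(complete_AP3_freeP no2); split.
  apply/AP3_freeP => _ _ _ /imsetP[x xS ->] /imsetP[y yS ->] /imsetP[z zS ->].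
  by rewrite addrACA [RHS]addrACA => /addIr xzy; rewrite (freeS x y z).
move=> x; have [b [y [z [yS zS c]]]] := spanS (x - v).
have im t : t \in S -> t + v \in [set x + v | x in S].
  by move=> tS; apply/imsetP; exists t.
exists b, (y + v), (z + v); split; rewrite ?im //.
rewrite -{1}(subrK v x); case: b c; rewrite /combines => /eqP c.
  by rewrite addrACA c addrACA.
by rewrite addrACA c addrACA.
Qed.

Lemma field_no2 (F : fieldType) (x : F) : 2 != 0 :> F -> x + x = 0 -> x = 0.
Proof.
by move=> two_neq0 /eqP; rewrite -mulr2n -mulr_natl mulf_eq0 (negPf two_neq0) => /eqP.
Qed.

Lemma odd_exponent_no2 p (G : finZmodType) : odd p -> (forall x : G, x *+ p = 0) ->
  forall x : G, x + x = 0 -> x = 0.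
Proof.
move=> p_odd expG x x2; rewrite -(expG x) -(odd_double_half p) p_odd.
by rewrite mulrnDr -mul2n mulrnA mulr2n x2 mul0rn addr0.
Qed.

(** Only the additive group matters, so the construction may be carried out in any
group of exponent p and of the right cardinality. *)
Lemma elementary_isomorphism p (G H : finZmodType) : prime p ->
    (forall x : G, x *+ p = 0) -> (forall x : H, x *+ p = 0) -> #|G| = #|H| ->
  exists2 f : G -> H, {morph f : x y / x + y} & bijective f.
Proof.
move=> pr_p expG expH eq_card.
have abelem (A : finZmodType) : (forall x : A, x *+ p = 0) -> (p.-abelem [set: A])%g.
  move=> expA; apply/(abelemP pr_p); split; first exact: FinRing.zmod_abelian.
  by move=> x _; rewrite FinRing.zmodXgE expA.
have /isogP[f f_inj _] : [set: G]%G \isog [set: H]%G.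
  by rewrite (isog_abelem_card _ (abelem G expG)) abelem // !cardsT eq_card eqxx.
exists f; first by move=> x y; rewrite -!FinRing.zmodMgE morphM ?inE.
apply: inj_card_bij; last by rewrite eq_card.
by move=> x y; apply: (injmP f_inj); rewrite inE.
Qed.

Lemma complete_AP3_free_elementary p (G H : finZmodType) : prime p -> odd p ->
    (forall x : G, x *+ p = 0) -> (forall x : H, x *+ p = 0) -> #|G| = #|H| ->
  forall S : {set G}, complete_AP3_free S ->
  exists2 T : {set H}, complete_AP3_free T & #|T| = #|S|.
Proof.
move=> pr_p p_odd expG expH eq_card S complS.
have [f fD f_bij] := elementary_isomorphism pr_p expG expH eq_card.
exists (f @: S); last by rewrite card_imset //; apply: bij_inj.
by apply: complete_AP3_free_imset; rewrite // => x; apply: odd_exponent_no2 p_odd _ x.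
Qed.

(** * Squares in finite fields *)

Definition nonsquare (F : fieldType) (a : F) := forall x, x * x <> a.

Lemma nonsquare_neq0 (F : fieldType) (a : F) : nonsquare a -> a != 0.
Proof. by move=> nsq_a; apply/eqP => a0; apply: (nsq_a 0); rewrite a0 mulr0. Qed.

Section FiniteField.

Variable F : finFieldType.

(** With respect to a generator of the cyclic group of units, nonsquares are the
odd powers, and the sum of two odd exponents is even. *)
Lemma nonsquare_mul (a b : F) : nonsquare a -> nonsquare b -> exists c, a * b = c * c.
Proof.
have /cyclicP[g genF] := field_unit_group_cyclic [set: {unit F}]%G.
have gen x : x != 0 -> exists i, x = (val g) ^+ i.
  move=> x_neq0; have [u <-] : exists u : {unit F}, val u = x.
    by exists (finField_unit x_neq0).
  have /cycleP[i ->] : u \in <[g]>%g by rewrite -genF inE.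
  by exists i; rewrite FinRing.val_unitX.
have odd_log c : nonsquare c -> exists i, c = val g ^+ (i.*2).+1.
  move=> nsq_c; have [i ci] := gen c (nonsquare_neq0 nsq_c).
  have [odd_i | even_i] := boolP (odd i).
    by exists i./2; rewrite ci -{1}(odd_double_half i) odd_i.
  case: (nsq_c (val g ^+ i./2)); rewrite ci -exprD addnn.
  by rewrite -{2}(odd_double_half i) (negPf even_i).
move=> /odd_log[i ->] /odd_log[j ->]; exists (val g ^+ (i + j).+1).
by rewrite -!exprD; congr (_ ^+ _); lia.
Qed.

Lemma nonsquare_exists : 2 != 0 :> F -> exists a : F, nonsquare a.
Proof.
move=> two_neq0; have [/existsP[a /existsP sq] | all_sq] :=
    boolP [exists a : F, ~~ [exists x : F, x * x == a]].
  by exists a => x xa; apply: sq; exists x; rewrite xa.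
have sq a : exists x : F, x * x == a.
  by apply/existsP; apply: contraNT all_sq => nsq; apply/existsP; exists a.
pose r a := xchoose (sq a); have rK a : r a * r a = a by apply/eqP/(xchooseP (sq a)).
have [s _ sK] : bijective r by apply: injF_bij => x y e; rewrite -(rK x) e rK.
have : s 1 = s (-1) by rewrite -(rK (s 1)) -(rK (s (-1))) !sK; ring.
move/(congr1 r); rewrite !sK => /eqP.
by rewrite -subr_eq0 opprK (negPf two_neq0).
Qed.

Lemma card_squares : (#|F| <= 2 * #|[set (x * x)%R | x : F]|)%N.
Proof.
rewrite -[leqLHS]sum1_card (partition_big_imset (fun x : F => x * x)) /= mulnC -sum_nat_const.
apply: leq_sum => a /imsetP[x _ ->]; rewrite sum1_card.
apply: (@leq_trans #|[set x; - x]|); last by rewrite cards2; case: (_ == _).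
apply: subset_leq_card; apply/subsetP => y; rewrite !inE.
by rewrite -eqf_sqr !expr2 => yx.
Qed.

Lemma card_le2_up_to_sign (P : pred F) : (forall x y, P x -> P y -> y = x \/ y = - x) ->
  (#|[set x | P x]| <= 2)%N.
Proof.
move=> pmP; have [-> | [x]] := set_0Vmem [set x | P x]; first by rewrite cards0.
rewrite inE => Px; apply: (@leq_trans #|[set x; - x]|); last by rewrite cards2; case: (_ == _).
apply: subset_leq_card; apply/subsetP => y; rewrite !inE => Py.
by case: (pmP x y Px Py) => ->; rewrite eqxx ?orbT.
Qed.

(** The norm form t1^2 - eta t2^2 represents every D <> 0, even with t1 outside two
given values.  If t1 admits no t2, then t1^2 - D is a nonzero square z^2, and
(t1 + z, t1 - z) is a factorization of D; each such t1 is recovered from either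
factor, so at most (|F| - 1) / 2 values of t1 are excluded. *)
Lemma conic_avoid (eta D e1 e2 : F) :
    2 != 0 :> F -> (4 < #|F|)%N -> nonsquare eta -> D != 0 ->
  exists t1 t2, [/\ t1 * t1 - eta * (t2 * t2) = D, t1 != e1 & t1 != e2].
Proof.
move=> two_neq0 F_gt4 nsq_eta D_neq0.
pose A := [set t1 | [exists t2, t1 * t1 - eta * (t2 * t2) == D]].
have [/subsetPn[t1] | /negPn subA] := boolP (~~ (A \subset [set e1; e2])).
  rewrite !inE negb_or => /existsP[t2 /eqP e] /andP[ne1 ne2].
  by exists t1, t2.
exfalso.
have sqrt_ex t : exists z, t \notin A -> t * t - D = z * z /\ z != 0.
  have [_ | tNA] /= := boolP (t \in A); first by exists 0.
  have notA s : t * t - eta * (s * s) <> D.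
    by move=> e; case/negP: tNA; rewrite inE; apply/existsP; exists s; apply/eqP.
  have ne0 : t * t - D != 0.
    by apply: contra_notN (@notA 0) => /eqP/subr0_eq <-; rewrite !mulr0 subr0.
  have [/existsP[z /eqP ze] | nsq] := boolP [exists z, t * t - D == z * z].
    exists z => _; split=> //; apply: contraNneq ne0 => z0.
    by rewrite ze z0 mulr0.
  have [c e] : exists c, (t * t - D) * eta = c * c.
    apply: nonsquare_mul => // z ze; case/negP: nsq; apply/existsP; exists z.
    by rewrite ze.
  case: (notA (c / eta)); have eta_neq0 := nonsquare_neq0 nsq_eta.
  have -> : eta * (c / eta * (c / eta)) = c * c / eta by field.
  by rewrite -e mulfK // subKr.
have [z zP] := fin_all_exists sqrt_ex.
(* f (t, true) and f (t, false) are the two factors of D attached to t. *)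
pose f (u : F * bool) := if u.2 then u.1 + z u.1 else u.1 - z u.1.
have prod_f t : t \notin A -> f (t, true) * f (t, false) = D.
  by move/zP=> [e _]; rewrite /f /= mulrC -subr_sqr !expr2 -e subKr.
have f_neq0 t b : t \notin A -> f (t, b) != 0.
  move=> tNA; apply: contraNneq D_neq0 => f0; rewrite -(prod_f t tNA).
  by case: b f0 => ->; rewrite ?mul0r ?mulr0.
have f_avg t b : t \notin A -> t = (f (t, b) + D / f (t, b)) / 2.
  move=> tNA; have := f_neq0 t b tNA; rewrite -(prod_f t tNA).
  case: b => ft_neq0; first by rewrite [f (t, true) * _]mulrC mulfK // /f /=; field.
  by rewrite mulfK // /f /=; field.
have f_inj : {in setX (~: A) [set: bool] &, injective f}.
  move=> [t b] [t' b']; rewrite !in_setX !in_setT !andbT !in_setC => tNA tNA' e.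
  have tt' : t = t' by rewrite (f_avg t b) // (f_avg t' b') // e.
  move: e; rewrite -tt'; have [_ z_neq0] := zP t tNA.
  have z_neq_Nz : t + z t <> t - z t.
    move/addrI/eqP; rewrite -subr_eq0 opprK -mulr2n -mulr_natl mulf_eq0.
    by rewrite (negPf two_neq0) (negPf z_neq0).
  by case: b; case: b' => // e; case: z_neq_Nz;
    rewrite -[LHS]/(f (t, true)) -[RHS]/(f (t, false)) e.
have cardNA : (#|~: A| * 2 <= #|F|.-1)%N.
  rewrite -card_bool -[#|{: bool}|]cardsT -cardsX -(card_in_imset f_inj).
  rewrite -(cardC1 (0 : F)); apply: subset_leq_card; apply/subsetP => _ /imsetP[[t b] tbA ->].
  by rewrite in_setX in_setC in_setT andbT in tbA; rewrite inE f_neq0.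
have cardA : (#|A| <= 2)%N.
  by apply: leq_trans (subset_leq_card subA) _; rewrite cards2; case: (_ == _).
have arith a c q : (4 < q -> a + c = q -> a <= 2 -> c * 2 <= q.-1 -> False)%N by lia.
exact: arith F_gt4 (cardsC A) cardA cardNA.
Qed.

(** One element is taken from each two-element orbit of the involution f of F \ 0:
the one that comes first in the enumeration of F. *)
Lemma involution_transversal (f : F -> F) (n : nat) :
    (forall x, x != 0 -> f x != 0 /\ f (f x) = x) ->
    (#|[set x : F | (x != 0%R) && (f x == x)]| <= n)%N ->
  exists I : {set F}, [/\ 0 \notin I, forall x, x \in I -> f x \notin I
    & (#|F| <= 2 * #|I| + n + 1)%N].
Proof.
move=> ff fixn; pose I := [set x | (x != 0) && (enum_rank x < enum_rank (f x))%N].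
have fI x : x \in I -> f x \notin I.
  rewrite !inE => /andP[/ff[fx_neq0 ->] lt_x]; rewrite fx_neq0 /=.
  by rewrite -leqNgt ltnW.
exists I; split=> //; first by rewrite inE eqxx.
have f_inj : {in [set x | x != 0] &, injective f}.
  by move=> x y; rewrite !inE => /ff[_ {2}<-] /ff[_ {2}<-] ->.
pose X := [set x | (x != 0) && (f x == x)].
have : [set x | x != 0] \subset I :|: f @: I :|: X.
  apply/subsetP => x; rewrite !inE => x_neq0; rewrite x_neq0 /=.
  have [fx_neq0 ffx] := ff x x_neq0.
  case: (ltngtP (enum_rank x) (enum_rank (f x))) => //= lt_x.
    suff -> : x \in f @: I by [].
    by apply/imsetP; exists (f x); rewrite // inE fx_neq0 ffx.
  by rewrite -(enum_rank_inj (val_inj lt_x)) eqxx orbT.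
move/subset_leq_card; have -> : #|[set x : F | x != 0]| = #|F|.-1.
  by rewrite -(cardC1 (0 : F)); apply: eq_card => x; rewrite !inE.
have arith q s3 s2 i j m : (q.-1 <= s3 -> s3 <= s2 + m -> s2 <= i + j -> j <= i -> m <= n ->
  q <= 2 * i + n + 1)%N by lia.
move=> le3; apply: arith le3 (leq_card_setU _ _) (leq_card_setU _ _) _ fixn.
exact: leq_imset_card.
Qed.

End FiniteField.

(** If z^2 = iota nu, the Frobenius map z -> z^q sends z to z or to - z.  In the first
case z lies in K.  In the second, iterating k times gives z^(q^k) = (-1)^k z = - z,
while z^(q^k) = z in L. *)
Lemma nonsquare_odd_extension (K L : finFieldType) (iota : {rmorphism K -> L}) k (nu : K) :
    2 != 0 :> L -> odd #|K| -> odd k -> #|L| = (#|K| ^ k)%N ->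
  nonsquare nu -> nonsquare (iota nu).
Proof.
move=> two_neq0 oddK oddk cardL nsq_nu z zz.
have zq : (z ^+ #|K| == z) || (z ^+ #|K| == - z).
  by rewrite -eqf_sqr -exprM mulnC exprM expr2 zz -rmorphXn expf_card.
case/orP: zq => /eqP zq.
  (* z and the q elements of iota K would be q + 1 roots of X^q - X. *)
  pose P : {poly L} := 'X^#|K| - 'X.
  have P_neq0 : P != 0.
    by rewrite -size_poly_eq0 size_polyDl size_polyXn // size_polyN size_polyX ltnS finNzRing_gt1.
  pose rs := z :: [seq iota x | x <- enum K].
  have : ~~ uniq rs.
    apply: contraTN (@leqnn #|K|) => Urs; rewrite -ltnNge.
    have := max_poly_roots P_neq0 _ Urs.
    rewrite /= size_map -cardE size_polyDl ?size_polyXn ?size_polyN ?size_polyX ?ltnS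
      ?finNzRing_gt1 //.
    apply; rewrite /root !hornerE zq subrr eqxx /=; apply/allP => _ /mapP[x _ ->].
    by rewrite /root !hornerE -rmorphXn expf_card subrr.
  rewrite /= map_inj_uniq ?enum_uniq ?andbT ?negbK; last exact: fmorph_inj.
  case/mapP=> x _ zx; apply: (nsq_nu x); apply: (fmorph_inj iota).
  by rewrite rmorphM -zx.
have zi i : z ^+ (#|K| ^ i) = (-1) ^+ i * z.
  elim: i => [|i IHi]; first by rewrite expn0 expr1 mul1r.
  by rewrite expnSr exprM IHi exprMn zq exprAC -[(-1) ^+ #|K|]signr_odd oddK expr1
    exprS mulrN mulN1r mulNr.
have := zi k; rewrite -cardL expf_card -signr_odd oddk expr1 mulN1r => /eqP.
rewrite -subr_eq0 opprK -mulr2n -mulr_natl mulf_eq0 (negPf two_neq0) /= => /eqP z0.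
by case/eqP: (nonsquare_neq0 nsq_nu); apply/eqP; rewrite -(fmorph_eq0 iota) -zz z0 mulr0.
Qed.

(** K is the fixed field of the r-th power of the Frobenius automorphism of the field
with p^(r k) elements. *)
Lemma finite_field_tower p r k : prime p -> (0 < r)%N -> (0 < k)%N ->
  exists K L : finFieldType, exists iota : {rmorphism K -> L},
    [/\ #|K| = (p ^ r)%N, #|L| = (p ^ (r * k))%N,
        forall x : K, x *+ p = 0 & forall x : L, x *+ p = 0].
Proof.
move=> pr_p r_gt0 k_gt0.
have rk_gt0 : (0 < r * k)%N by rewrite muln_gt0 r_gt0.
have [F pcharF cardF] := pPrimePowerField pr_p rk_gt0.
pose L : splittingFieldType 'F_p := pPrimeCharType pcharF.
have dimL : \dim {:L} = (r * k)%N.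
  by rewrite [LHS]pprimeChar_dimf cardF pfactorK.
have galL : galois (1%AS : {subfield L}) {:L} by apply: finField_galois (sub1v _).
have [/= a gen_a Da] := finField_galois_generator (sub1v {:L}).
have order_a : #[a]%g = (r * k)%N.
  have := galois_dim galL; rewrite dimv1 divn1 dimL (eqP gen_a). by move->.
pose E := fixedField <[a ^+ r]>%g.
have dimE : \dim E = r.
  have := dim_fixedField <[a ^+ r]>%G; rewrite -[#|_|]/(#[a ^+ r]%g) dimL.
  rewrite orderXdiv order_a ?dvdn_mulr // mulKn // => k_def.
  have /dvdnP[c cE] : (\dim E %| r * k)%N by rewrite -dimL field_dimS ?subvf.
  move: k_def; rewrite -/E cE mulnK; last by rewrite adim_gt0.
  move=> kc; apply/eqP; rewrite -(eqn_pmul2r k_gt0); apply/eqP.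
  by rewrite cE -kc mulnC.
pose K : fieldExtType 'F_p := subvs_of E.
pose KF : finFieldType := FinFieldExtType K.
exists KF.
exists F.
exists (vsval : K -> L).
split=> //.
- have := @card_vspacef 'F_p KF (Vector.class K).
  rewrite card_vspace => <-.
  by rewrite card_Fp // dimvf -dimE.
- move=> x; apply: val_inj; rewrite raddfMn /=.
  by rewrite -mulr_natr (pcharf0 pcharF) mulr0.
by move=> x; rewrite -mulr_natr (pcharf0 pcharF) mulr0.
Qed.

(** * Independent conditions on a random function *)

(** In probabilistic terms: each of the conditions bad i (w (a i)) (w (b i)) holds with
probability at most 1/2 over the value w (b i), which does not enter any
other condition, so all of them hold with probability at most 2^-(size s).
The induction step resamples w (b i). *)
Lemma card_all_bad (A K : finType) (I : eqType) (s : seq I) (a b : I -> A)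
    (bad : I -> K -> K -> bool) : uniq s ->
    {in s &, forall i j, b i != a j} -> {in s &, injective b} ->
    (forall i x, 2 * #|[set y | bad i x y]| <= #|K|)%N ->
  (2 ^ size s * #|[set w : {ffun A -> K} | all (fun i => bad i (w (a i)) (w (b i))) s]|
     <= #|{: {ffun A -> K}}|)%N.
Proof.
move=> + + + few_bad; elim: s => [|i s IHs] /=; first by rewrite mul1n max_card.
case/andP=> i_notin_s Us ba_neq b_inj.
have {}IHs := IHs Us
  (sub_in2 (fun j => @mem_behead _ (i :: s) j) ba_neq)
  (sub_in2 (fun j => @mem_behead _ (i :: s) j) b_inj).
move: IHs.
set X := [set w | _]; set X' := [set w | _] => IHs.
apply: leq_trans IHs; rewrite expnS mulnAC mulnC leq_mul2l; apply/orP; right.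
have [K0 | K_gt0] := posnP #|K|.
  have -> : #|X'| = 0%N; last by [].
  apply/eqP; rewrite cards_eq0; apply/eqP/setP => w; rewrite !inE.
  by have := card0_eq K0 (w (b i)); rewrite inE.
pose upd (w : {ffun A -> K}) y := [ffun x => if x == b i then y else w x].
pose Y := [set u : {ffun A -> K} * K | (u.1 \in X) && bad i (u.1 (a i)) u.2].
(* phi exchanges the resampled value with the old one. *)
pose phi (u : {ffun A -> K} * K) := (upd u.1 u.2, u.1 (b i)).
have phiK : involutive phi.
  case=> w y; rewrite /phi /= ffunE eqxx; congr (_, _).
  by apply/ffunP => x; rewrite !ffunE; case: eqP => // ->.
have cardY : (#|X'| * #|K| <= #|Y|)%N.
  rewrite -(cardsT K) -cardsX -(card_imset _ (inv_inj phiK)).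
  apply: subset_leq_card; apply/subsetP => _ /imsetP[[w y] + ->].
  rewrite in_setX inE /= in_setT andbT => /andP[bad_i bad_s].
  rewrite !inE /= ffunE eq_sym (negPf (ba_neq i i _ _)) ?mem_head // bad_i andbT.
  apply/allP => j js; have := allP bad_s j js; rewrite !ffunE.
  rewrite eq_sym (negPf (ba_neq i j _ _)) ?inE ?eqxx ?js ?orbT //.
  case: eqP => // bji; case/negP: i_notin_s.
  by rewrite -(b_inj j i _ _ bji) // inE ?eqxx ?js ?orbT.
rewrite -(leq_pmul2r K_gt0) -mulnA; apply: (leq_trans (leq_mul (leqnn 2) cardY)).
have -> : #|Y| = (\sum_(w in X) #|[set y | bad i (w (a i)) y]|)%N.
  rewrite -sum1_card (partition_big fst (mem X)) /=; last by move=> u; rewrite inE => /andP[].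
  apply: eq_bigr => w wX; have pair_inj : injective (pair w : K -> _) by move=> y z [].
  rewrite sum1_card -[RHS](card_imset _ pair_inj).
  apply: eq_card => -[w' y]; rewrite [LHS]unfold_in /= inE /=.
  apply/andP/imsetP => [[/andP[_ bad_y] /eqP ew]|[z]].
    by exists y; rewrite ?inE -?ew.
  by rewrite inE => bad_z [-> ->]; rewrite wX bad_z eqxx.
rewrite big_distrr /= -sum_nat_const; apply: leq_sum => w _; exact: few_bad.
Qed.

(** * Choosing the heights *)

Section Tower.

Variables (K L : finFieldType) (iota : {rmorphism K -> L}) (eta : K).
Hypotheses (twoK : 2 != 0 :> K) (twoL : 2 != 0 :> L).
Hypotheses (nsqK : nonsquare eta) (nsqL : nonsquare (iota eta)).

(** Up to squares, L has the same two nonzero classes as K, represented by 1 and eta. *)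
Lemma square_class (Z : L) : exists2 nu : K, nu != 0 & exists z, Z = iota nu * (z * z).
Proof.
have [/existsP[z /eqP Ez] | nsq] := boolP [exists z, Z == z * z].
  by exists 1; [rewrite oner_eq0 | exists z; rewrite rmorph1 mul1r].
have [c e] : exists c, Z * iota eta = c * c.
  apply: nonsquare_mul => // z ze; case/negP: nsq; apply/existsP; exists z.
  by rewrite ze.
exists eta; first exact: nonsquare_neq0 nsqK.
have ne := nonsquare_neq0 nsqL.
exists (c / iota eta).
have -> : iota eta * (c / iota eta * (c / iota eta)) = c * c / iota eta by field.
by rewrite -e mulfK.
Qed.

Section Options.

Variables l1 l2 : K.
Hypotheses (l1_neq0 : l1 != 0) (l2_neq0 : l2 != 0) (l12 : l1 + l2 = 1).

(** The points off all the curves a |-> (x, x a, x a^2), with those of x = u = 0 removed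
as well: the points for which a1 <> a2 is forced in the equations of balances. *)
Definition generic_target (x : K) (u v : L) :=
  if x == 0 then u != 0 else iota x * v != u * u.

(** (x, u, v) is the l1, l2 weighted mean of two points (g, g a, g a^2) with g <> 0. *)
Definition balances (x : K) (u v : L) (g1 g2 : K) (a1 a2 : L) :=
  [/\ g1 != 0, g2 != 0, l1 * g1 + l2 * g2 = x,
      iota (l1 * g1) * a1 + iota (l2 * g2) * a2 = u
    & iota (l1 * g1) * (a1 * a1) + iota (l2 * g2) * (a2 * a2) = v].

(** A generic target is balanced in about |K| / 2 ways using pairwise disjoint pairs
(a1, a2).  For x <> 0, put U = u / x and v / x - U^2 = iota nu z^2.  The parameter i
fixes the ratio rho = nu i^2 of the masses l2 g2 and l1 g1; the mean U and the
variance iota nu z^2 then give a1 = U + iota (nu i) z and a2 = U - z / iota i.  For x = 0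
the masses are opposite, and a1 - a2, a1 + a2 are determined by u and v.  In both cases
an involution of the parameter exchanges a1 and a2, so only one parameter out of
each orbit is kept; for x <> 0 its fixed points are the excluded case rho = -1. *)
Lemma pair_options (x : K) (u v : L) : generic_target x u v ->
  exists (I : {set K}) (g1 g2 : K -> K) (a1 a2 : K -> L),
   [/\ (#|K| <= 2 * #|I| + 3)%N, {in I &, injective a2}, {in I &, forall i j, a2 i != a1 j}
     & {in I, forall i, balances x u v (g1 i) (g2 i) (a1 i) (a2 i)}].
Proof.
rewrite /generic_target; have [-> u_neq0 | x_neq0 Z_neq0] := eqVneq x 0.
  have [||I [I0 NI cardI]] := @involution_transversal K -%R 0.
  - by move=> t; rewrite oppr_eq0 opprK.
  - rewrite leqn0 cards_eq0; apply/eqP/setP => t; rewrite !inE.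
    apply/andP=> -[t_neq0 /eqP Nt]; case/eqP: t_neq0; apply: field_no2 => //.
    by rewrite -{1}Nt addNr.
  have t_neq0 t : t \in I -> t != 0 by apply: contraTneq => ->.
  have k_neq0 : iota l1 * iota l2 != 0 by rewrite mulf_neq0 ?fmorph_eq0.
  exists I, (fun t => l2 * t), (fun t => - (l1 * t)).
  exists (fun t => (v / u + u / (iota l1 * iota l2 * iota t)) / 2).
  exists (fun t => (v / u - u / (iota l1 * iota l2 * iota t)) / 2).
  have inj_half (y y' : L) : y / 2 = y' / 2 -> y = y'.
    by apply: mulIf; rewrite invr_eq0.
  have inj_inv t t' :
      u / (iota l1 * iota l2 * iota t) = u / (iota l1 * iota l2 * iota t') ->
      t = t'.
    by move/(mulfI u_neq0)/invr_inj/(mulfI k_neq0); apply: fmorph_inj.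
  split=> [|t t' tI t'I|t t' tI t'I|t tI]; first by apply: leq_trans cardI _; lia.
  - by move/inj_half/addrI/oppr_inj/inj_inv.
  - apply/eqP => /inj_half/addrI e; have t0 := t_neq0 t tI.
    case/negP: (NI t tI); suff -> : - t = t' by [].
    apply: inj_inv; rewrite -e rmorphN; field.
    by rewrite oppr_eq0 !fmorph_eq0 l1_neq0 l2_neq0 t0.
  - have T_neq0 : iota t != 0 by rewrite fmorph_eq0 t_neq0.
    have L1 : iota l1 != 0 by rewrite fmorph_eq0.
    have L2 : iota l2 != 0 by rewrite fmorph_eq0.
    have nz1 : l2 * t != 0 by rewrite mulf_neq0 // t_neq0.
    have nz2 : - (l1 * t) != 0 by rewrite oppr_eq0 mulf_neq0 // t_neq0.
    split=> //; first by ring.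
      by rewrite !rmorphM rmorphN !rmorphM; field; rewrite ?twoL ?u_neq0 ?T_neq0 ?L1 ?L2.
    by rewrite !rmorphM rmorphN !rmorphM; field; rewrite ?twoL ?u_neq0 ?T_neq0 ?L1 ?L2.
have [nu nu_neq0 [z Ez]] := square_class (v / iota x - (u / iota x) * (u / iota x)).
have X_neq0 : iota x != 0 by rewrite fmorph_eq0.
have N_neq0 : iota nu != 0 by rewrite fmorph_eq0.
have z_neq0 : z != 0.
  apply: contraNneq Z_neq0 => z0; move: Ez; rewrite z0 !mulr0 => /eqP.
  rewrite subr_eq0 => /eqP Ev; apply/eqP.
  have -> : v = (v / iota x) * iota x by field.
  by rewrite Ev; field.
have [||I [I0 fI cardI]] := @involution_transversal K (fun i => - (nu * i)^-1) 2.
- move=> i i_neq0; rewrite oppr_eq0 invr_eq0 mulf_neq0 //; split=> //.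
  by field; rewrite i_neq0 nu_neq0 oppr_eq0 oner_eq0.
- apply: card_le2_up_to_sign => i j /andP[i_neq0 /eqP ei] /andP[j_neq0 /eqP ej].
  have sq k : k != 0 -> - (nu * k)^-1 = k -> k ^+ 2 = - nu^-1.
    by move=> k_neq0 ek; rewrite expr2 -{1}ek; field; rewrite nu_neq0.
  have : (j == i) || (j == - i) by rewrite -eqf_sqr !sq.
  by case/orP=> /eqP; [left | right].
have ok i : i \in I -> i != 0 /\ 1 + nu * (i * i) != 0.
  move=> iI; have i_neq0 : i != 0 by apply: contraNneq I0 => <-.
  split=> //; apply: contraNneq (fI i iI) => e; suff -> : - (nu * i)^-1 = i by [].
  have : nu * i != 0 by rewrite mulf_neq0.
  move/mulfI; apply; rewrite mulrN mulfV ?mulf_neq0 //.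
  by apply/eqP; rewrite eq_sym -addr_eq0 addrC -mulrA e.
exists I, (fun i => x / (l1 * (1 + nu * (i * i)))).
exists (fun i => nu * (i * i) * x / (l2 * (1 + nu * (i * i)))).
exists (fun i => u / iota x + iota (nu * i) * z), (fun i => u / iota x - z / iota i).
split=> [|i j iI jI|i j iI jI|i iI]; first by apply: leq_trans cardI _; lia.
- move/addrI/oppr_inj/(mulfI z_neq0)/invr_inj; exact: fmorph_inj.
- apply/eqP => /addrI e; have [i_neq0 _] := ok i iI; have [j_neq0 _] := ok j jI.
  case/negP: (fI j jI); suff <- : i = - (nu * j)^-1 by [].
  apply: (fmorph_inj iota); rewrite rmorphN fmorphV.
  have J_neq0 : iota (nu * j) != 0 by rewrite fmorph_eq0 mulf_neq0.
  have I_neq0 : iota i != 0 by rewrite fmorph_eq0.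
  apply: (mulfI J_neq0); apply: (mulfI z_neq0); rewrite mulrN mulfV // mulrN1.
  by rewrite [iota _ * _]mulrC mulrCA [z * _]mulrC -e mulrN mulrCA mulfV ?mulr1.
- have [i_neq0 d_neq0] := ok i iI.
  have I_neq0 : iota i != 0 by rewrite fmorph_eq0.
  have D_neq0 : 1 + iota nu * (iota i * iota i) != 0.
    by rewrite -!rmorphM -(rmorph1 iota) -rmorphD fmorph_eq0.
  have E1 : l1 * (x / (l1 * (1 + nu * (i * i)))) = x / (1 + nu * (i * i)).
    by field; rewrite d_neq0.
  have E2 : l2 * (nu * (i * i) * x / (l2 * (1 + nu * (i * i)))) =
      nu * (i * i) * x / (1 + nu * (i * i)).
    by field; rewrite d_neq0.
  have nz1 : x / (l1 * (1 + nu * (i * i))) != 0 by rewrite mulf_neq0 // invr_eq0 mulf_neq0.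
  have nz2 : nu * (i * i) * x / (l2 * (1 + nu * (i * i))) != 0.
    by rewrite !mulf_neq0 // invr_eq0 mulf_neq0.
  split; rewrite ?E1 ?E2 //; first by field.
    rewrite !fmorph_div !rmorphM rmorphD !rmorphM rmorph1; field.
    by rewrite I_neq0 X_neq0 D_neq0.
  have -> : v = iota x * (v / iota x - u / iota x * (u / iota x)) + u * u / iota x by field.
  rewrite Ez !fmorph_div !rmorphM rmorphD !rmorphM rmorph1; field.
  by rewrite I_neq0 X_neq0 D_neq0.
Qed.

(** For fixed alpha, the good beta form an affine image of the set of squares. *)
Lemma few_bad_heights (c e alpha : K) : e != 0 ->
  (2 * #|[set beta : K | ~~ [exists t : K,
     (l1 * alpha + l2 * beta == c + e * (t * t))%R]]| <= #|K|)%N.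
Proof.
move=> e_neq0; pose h (z : K) := (c + e * z - l1 * alpha) / l2.
have h_inj : injective h.
  by move=> z z' /(mulIf (invr_neq0 l2_neq0)) /addIr /addrI /(mulfI e_neq0).
pose good := h @: [set z * z | z : K].
have card_good : (#|K| <= 2 * #|good|)%N by rewrite card_imset //; apply: card_squares.
set bad := [set beta | _].
have bad_sub : bad \subset ~: good.
  apply/subsetP => beta; rewrite !inE; apply: contra => /imsetP[_ /imsetP[t _ ->] ->].
  by apply/existsP; exists t; apply/eqP; rewrite /h; field.
have arith g g' b q : (g + g' = q -> q <= 2 * g -> b <= g' -> 2 * b <= q)%N by lia.
exact: arith (cardsC good) card_good (subset_leq_card bad_sub).
Qed.

Definition height (x s : K) := x * x - eta * (s * s).

Lemma sqr_eq_nonsquare (x s : K) : x * x = eta * (s * s) -> x = 0 /\ s = 0.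
Proof.
move=> e; have [s0 | s_neq0] := eqVneq s 0.
  by split=> //; apply/eqP; rewrite -[x == 0]orbb -mulf_eq0 e s0 !mulr0.
case: (nsqK (x := x / s)); have -> : x / s * (x / s) = x * x / (s * s) by field.
by rewrite e mulfK // mulf_neq0.
Qed.

Lemma height_midpoint x1 x2 x3 s1 s2 s3 : x1 + x3 = x2 + x2 -> s1 + s3 = s2 + s2 ->
    height x1 s1 + height x3 s3 = height x2 s2 + height x2 s2 ->
  x1 = x3 /\ s1 = s3.
Proof.
move=> ex es eh; have : (x1 - x3) * (x1 - x3) = eta * ((s1 - s3) * (s1 - s3)).
  apply/eqP; rewrite -subr_eq0; apply/eqP.
  have -> : (x1 - x3) * (x1 - x3) - eta * ((s1 - s3) * (s1 - s3)) =
    2 * (height x1 s1 + height x3 s3)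
    - ((x1 + x3) * (x1 + x3) - eta * ((s1 + s3) * (s1 + s3))) by rewrite /height; ring.
  by rewrite eh ex es /height; ring.
case/sqr_eq_nonsquare => /eqP; rewrite subr_eq0 => /eqP-> /eqP.
by rewrite subr_eq0 => /eqP->.
Qed.

(** (x, s, y, u, v) is the l1, l2 weighted mean of two points
(g, s', height g s' + omega a, g a, g a^2) with g <> 0. *)
Definition reachable (omega : {ffun L -> K}) (x s y : K) (u v : L) :=
  exists g1 g2 s1 s2 a1 a2, [/\ balances x u v g1 g2 a1 a2, l1 * s1 + l2 * s2 = s
    & l1 * (height g1 s1 + omega a1) + l2 * (height g2 s2 + omega a2) = y].

(** B consists of the omega for which every option fails.  Once an option has fixed
g1, g2, a1 and a2, moving s1 and s2 apart by t with l1 s1 + l2 s2 = s changes the mean height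
by - eta l1 l2 t^2. *)
Lemma few_unreaching_heights (x s y : K) (u v : L) : generic_target x u v ->
  exists2 B : {set {ffun L -> K}},
    (2 ^ ((#|K| - 3)./2) * #|B| <= #|{: {ffun L -> K}}|)%N
    & forall omega, omega \notin B -> reachable omega x s y u v.
Proof.
case/pair_options=> I [g1 [g2 [a1 [a2 [cardI a2_inj a21_neq bal]]]]].
pose c i := y - l1 * (g1 i * g1 i) - l2 * (g2 i * g2 i) + eta * (s * s).
pose bad i alpha beta :=
  ~~ [exists t : K, l1 * alpha + l2 * beta == c i + eta * l1 * l2 * (t * t)].
exists [set omega : {ffun L -> K} | all (fun i => bad i (omega (a1 i)) (omega (a2 i))) (enum I)].
  have le2 : (2 ^ ((#|K| - 3)./2) <= 2 ^ size (enum I))%N.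
    rewrite leq_exp2l // -cardE.
    have arith m n : (m <= 2 * n + 3 -> (m - 3)./2 <= n)%N by lia.
    exact: arith cardI.
  apply: leq_trans (leq_mul le2 (leqnn _)) _.
  apply: card_all_bad; first exact: enum_uniq.
  - by move=> i j; rewrite !mem_enum; apply: a21_neq.
  - by move=> i j; rewrite !mem_enum; apply: a2_inj.
  - move=> i alpha; apply: few_bad_heights.
    by rewrite !mulf_neq0 // nonsquare_neq0.
move=> omega; rewrite inE => /allPn[i]; rewrite mem_enum => iI.
rewrite negbK => /existsP[t /eqP Et].
exists (g1 i), (g2 i), (s + l2 * t), (s - l1 * t), (a1 i), (a2 i); split; first exact: bal.
  by rewrite -[RHS]mul1r -l12; ring.
have El2 : l2 = 1 - l1 by rewrite -l12; ring.
rewrite /height; have -> : y = c i + l1 * (g1 i * g1 i) + l2 * (g2 i * g2 i) - eta * (s * s).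
  by rewrite /c; ring.
have -> : c i = l1 * omega (a1 i) + l2 * omega (a2 i) - eta * l1 * l2 * (t * t).
  by rewrite Et; ring.
by rewrite El2; ring.
Qed.

End Options.

(** In a field of odd characteristic, combines b x y z says that x is the weighted mean of
y and z with weights 1/2, 1/2 (midpoint) or 2, -1 (continuation). *)
Definition weight1 (F : fieldType) (b : bool) : F := if b then 2 else 2^-1.
Definition weight2 (F : fieldType) (b : bool) : F := if b then -1 else 2^-1.

Lemma combinesE (F : fieldType) b (x y z : F) : 2 != 0 :> F ->
  combines b x y z = (weight1 F b * y + weight2 F b * z == x).
Proof.
move=> two_neq0; case: b; rewrite /combines /weight1 /weight2.
  by rewrite mulN1r subr_eq mulr_natl mulr2n eq_sym.
rewrite -mulrDr -[RHS](inj_eq (mulfI two_neq0)) mulVKf // mulr_natl mulr2n.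
by rewrite eq_sym.
Qed.

Lemma weights b : [/\ weight1 K b != 0, weight2 K b != 0 & weight1 K b + weight2 K b = 1].
Proof.
case: b; rewrite /weight1 /weight2 ?oppr_eq0 ?oner_eq0 ?invr_eq0 ?twoK; split=> //; first by ring.
by field.
Qed.

Lemma iota_weight b : (weight1 L b = iota (weight1 K b)) * (weight2 L b = iota (weight2 K b)).
Proof. by case: b; rewrite /weight1 /weight2 ?rmorphN ?fmorphV ?rmorph1 ?rmorph_nat. Qed.

(** Union bound over the 2 |K|^3 |L|^2 pairs of a kind of combination and a target. *)
Lemma reaching_heights :
    (2 * (#|K| ^ 3 * #|L| ^ 2) < 2 ^ ((#|K| - 3)./2))%N ->
  exists omega : {ffun L -> K}, forall b x s y u v, generic_target x u v ->
    reachable (weight1 K b) (weight2 K b) omega x s y u v.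
Proof.
move=> few; set M := ((#|K| - 3)./2)%N in few.
pose T := (bool * ((K * K * K) * (L * L)))%type.
pose Om := {ffun L -> K}.
have ex (t : T) : exists2 B : {set Om}, (2 ^ M * #|B| <= #|{: Om}|)%N
    & forall omega, omega \notin B -> generic_target t.2.1.1.1 t.2.2.1 t.2.2.2 ->
      reachable (weight1 K t.1) (weight2 K t.1) omega t.2.1.1.1 t.2.1.1.2 t.2.1.2 t.2.2.1 t.2.2.2.
  case: t => b [[[x s] y] [u v]] /=; have [l1_neq0 l2_neq0 l12] := weights b.
  have [gen | ngen] := boolP (generic_target x u v); last first.
    by exists set0 => //; rewrite cards0 muln0.
  have [B cardB reach] := few_unreaching_heights l1_neq0 l2_neq0 l12 s y gen.
  by exists B => // omega /reach.
have [B cardB reach] := fin_all_exists2 ex.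
suff /subsetPn[omega _ omegaNB] : ~~ ([set: Om] \subset \bigcup_t B t).
  exists omega => b x s y u v; apply: (reach (b, ((x, s, y), (u, v)))) => /=.
  by apply: contra omegaNB => omegaB; apply/bigcupP; exists (b, ((x, s, y), (u, v))).
apply/negP => /subset_leq_card; rewrite cardsT => cardOm.
have Om_gt0 : (0 < #|{: Om}|)%N by apply/card_gt0P; exists [ffun=> 0].
have cardU : (#|\bigcup_t B t| <= \sum_t #|B t|)%N.
  elim/big_rec2: _ => [|t n U _ le_n]; first by rewrite cards0.
  by apply: leq_trans (leq_card_setU _ _) _; rewrite leq_add2l.
have : (2 ^ M * #|{: Om}| <= #|{: T}| * #|{: Om}|)%N.
  apply: leq_trans (leq_mul (leqnn _) (leq_trans cardOm cardU)) _.
  by rewrite big_distrr /= -sum_nat_const; apply: leq_sum => t _.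
rewrite leq_pmul2r // leqNgt => /negP; apply; apply: leq_ltn_trans few.
by rewrite !card_prod card_bool -mulnn !expnS expn0 muln1 !mulnA.
Qed.

Section Heights.

Variable omega : {ffun L -> K}.
Hypothesis K_gt4 : (4 < #|K|)%N.
Hypothesis reach : forall b x s y u v, generic_target x u v ->
  reachable (weight1 K b) (weight2 K b) omega x s y u v.

(** If omega were constant, say c, the midpoint target (1, 0, 1 + c, 0, iota eta) could not be
reached: its height forces g1 = g2 = 1, hence a2 = - a1 and a1^2 = iota eta. *)
Lemma heights_nonconstant c : exists a, omega a != c.
Proof.
have [/existsP[a wa] | const] := boolP [exists a, omega a != c]; first by exists a.
have {}const a : omega a = c.
  by apply/eqP; apply: contraNT const => wa; apply/existsP; exists a.
have gen : generic_target 1 0 (iota eta).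
  by rewrite /generic_target oner_eq0 rmorph1 mul1r mulr0; apply: nonsquare_neq0 nsqL.
have [g1 [g2 [s1 [s2 [a1 [a2 [[_ _ Eg Eu Ev] Es]]]]]]] := reach false 0 (1 + c) gen.
rewrite /weight1 /weight2 /= in Eg Eu Ev Es *; rewrite !const /height => Ey.
have half2 : 2^-1 * 2 = 1 :> K by rewrite mulVf.
have Eg2 : g2 = 2 - g1.
  have {1}-> : g2 = 2 * (2^-1 * g1 + 2^-1 * g2) - g1 by field.
  by rewrite Eg mulr1.
have Es2 : s2 = - s1.
  by apply/eqP; rewrite -addr_eq0 addrC -(inj_eq (mulfI (invr_neq0 twoK))) mulr0 mulrDr Es.
have [g1_1 s1_0] : g1 - 1 = 0 /\ s1 = 0.
  apply: sqr_eq_nonsquare; apply/eqP; rewrite -subr_eq0; apply/eqP.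
  rewrite -[RHS](subrr (1 + c)) -{1}Ey Eg2 Es2; field.
  exact: twoK.
have g1E : g1 = 1 by apply/eqP; rewrite -subr_eq0 g1_1.
have g2E : g2 = 1 by rewrite Eg2 g1E; ring.
move: Eu Ev; rewrite g1E g2E !mulr1 !fmorphV !rmorph_nat => Eu Ev.
have Ea2 : a2 = - a1.
  by apply/eqP; rewrite -addr_eq0 addrC -(inj_eq (mulfI (invr_neq0 twoL))) mulr0 mulrDr Eu.
by case: (nsqL (x := a1)); rewrite -Ev Ea2; field.
Qed.

(** On the copy of K^3 belonging to a, both points are taken with this same a; it remains to
write the error y - height x s - omega a in height as l1 l2 (t1^2 - eta t2^2).  The two
excluded values of t1 are those at which g1 = x + l2 t1 or g2 = x - l1 t1 vanishes. *)
Lemma reach_on_line b x s y a : (x != 0) || (y - height x s - omega a != 0) ->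
  reachable (weight1 K b) (weight2 K b) omega x s y (iota x * a) (iota x * (a * a)).
Proof.
have [l1_neq0 l2_neq0 l12] := weights b; set l1 := weight1 K b; set l2 := weight2 K b.
have El2 : l2 = 1 - l1 by rewrite -l12 addrC addKr.
have [D0 | D_neq0 _] := eqVneq (y - height x s - omega a) 0.
  rewrite orbF => x_neq0; exists x, x, s, s, a, a; split.
  - split; rewrite // ?El2; first by ring.
    + by rewrite !rmorphM rmorphB rmorph1; ring.
    + by rewrite !rmorphM rmorphB rmorph1; ring.
  - by rewrite El2; ring.
  - by rewrite -[RHS](subrK (height x s)) -[X in _ = X + _](subrK (omega a)) D0 El2; ring.
have Dl_neq0 : (y - height x s - omega a) / (l1 * l2) != 0.
  by rewrite mulf_neq0 // invr_eq0 mulf_neq0.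
have [t1 [t2 [Et t1_ne t1_ne']]] := conic_avoid (- (x / l2)) (x / l1) twoK K_gt4 nsqK Dl_neq0.
have ED : y - height x s - omega a = (t1 * t1 - eta * (t2 * t2)) * (l1 * l2).
  by rewrite Et mulfVK // mulf_neq0.
exists (x + l2 * t1), (x - l1 * t1), (s + l2 * t2), (s - l1 * t2), a, a; split.
- split.
  + apply: contraNneq t1_ne => e; apply/eqP/(mulfI l2_neq0).
    by rewrite mulrN mulrCA mulfV // mulr1; apply/eqP; rewrite -addr_eq0 addrC e.
  + apply: contraNneq t1_ne' => e; apply/eqP/(mulfI l1_neq0).
    by rewrite mulrCA mulfV // mulr1; apply/esym/eqP; rewrite -subr_eq0 e.
  + by rewrite El2; ring.
  + by rewrite -mulrDl -rmorphD; congr (iota _ * _); rewrite El2; ring.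
  + by rewrite -mulrDl -rmorphD; congr (iota _ * _); rewrite El2; ring.
- by rewrite El2; ring.
- have -> : y = (t1 * t1 - eta * (t2 * t2)) * (l1 * l2) + height x s + omega a.
    by rewrite -ED; ring.
  by rewrite /height El2; ring.
Qed.

(** For x = u = v = 0 the point lies on the closure of the copies belonging to all a, and an a
with a nonzero error in height is used. *)
Lemma reach_all b x s y u v : (x != 0) || (u != 0) || (v == 0) ->
  reachable (weight1 K b) (weight2 K b) omega x s y u v.
Proof.
move=> xuv; have [gen | ] := boolP (generic_target x u v); first exact: reach.
rewrite /generic_target; have [x0 | x_neq0] := eqVneq x 0.
  rewrite negbK => /eqP u0; move: xuv; rewrite x0 u0 !eqxx /= => /eqP->.
  have [a wa] := heights_nonconstant (y - height 0 s).
  have /(reach_on_line b) : (0 != 0 :> K) || (y - height 0 s - omega a != 0).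
    by rewrite eqxx subr_eq0 eq_sym.
  by rewrite rmorph0 !mul0r.
rewrite negbK => /eqP Ev; have X_neq0 : iota x != 0 by rewrite fmorph_eq0.
have -> : v = iota x * (u / iota x * (u / iota x)).
  by apply: (mulfI X_neq0); rewrite Ev; field.
have {1}-> : u = iota x * (u / iota x) by field.
by apply: reach_on_line; rewrite x_neq0.
Qed.

End Heights.

End Tower.

(** * The ruled set is complete *)

(** The componentwise group law on A * B as one finite abelian group, so that such products
can be nested. *)
Definition prodZ (A B : finZmodType) : finZmodType :=
  HB.pack (A * B)%type (GRing.Zmodule.class (A * B)%type) (Finite.class (A * B)%type).

Lemma prodZ_addE (A B : finZmodType) (a1 a2 : A) (b1 b2 : B) :
  ((a1, b1) : prodZ A B) + (a2, b2) = (a1 + a2, b1 + b2).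
Proof. by []. Qed.

Lemma combines_prodZ (A B : finZmodType) b (a1 a2 a3 : A) (b1 b2 b3 : B) :
  combines b ((a1, b1) : prodZ A B) (a2, b2) (a3, b3) =
    combines b a1 a2 a3 && combines b b1 b2 b3.
Proof. by case: b. Qed.

Section Construction.

Variables (K L : finFieldType) (iota : {rmorphism K -> L}) (eta : K) (Phi : finZmodType).
Hypotheses (twoK : 2 != 0 :> K) (twoL : 2 != 0 :> L).
Hypothesis no2Phi : forall w : Phi, w + w = 0 -> w = 0.
Hypothesis nsqK : nonsquare eta.
Variable omega : {ffun L -> K}.
Hypothesis reach : forall b x s y u v, (x != 0) || (u != 0) || (v == 0) ->
  reachable iota eta (weight1 K b) (weight2 K b) omega x s y u v.

(** The coordinates (x, s, y, w, u, v) are grouped as ((x, s), ((y, w), (u, v))); the floor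
is the subgroup x = u = 0. *)
Definition floor_group := prodZ K (prodZ (prodZ K Phi) L).
Definition full_group := prodZ (prodZ K K) (prodZ (prodZ K Phi) (prodZ L L)).

Variables (W : {set Phi}) (floor : {set floor_group}).
Hypotheses (complW : complete_AP3_free W) (complFloor : complete_AP3_free floor).
Hypothesis floor_v : forall s y w v, ((s, ((y, w), v)) : floor_group) \in floor -> v != 0.

Definition curved (q : (K * K) * (Phi * L)) : full_group :=
  ((q.1.1, q.1.2), ((height eta q.1.1 q.1.2 + omega q.2.2, q.2.1),
     (iota q.1.1 * q.2.2, iota q.1.1 * (q.2.2 * q.2.2)))).

Definition floor_in (q : floor_group) : full_group :=
  ((0, q.1), (q.2.1, (0, q.2.2))).

Definition ruled_set : {set full_group} :=
  curved @: [set q | (q.1.1 != 0) && (q.2.1 \in W)] :|: floor_in @: floor.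

Lemma card_ruled_set : (#|ruled_set| <= #|K| ^ 2 * #|W| * #|L| + #|floor|)%N.
Proof.
apply: leq_trans (leq_card_setU _ _) _; apply: leq_add; last exact: leq_imset_card.
apply: leq_trans (leq_imset_card _ _) _.
apply: (@leq_trans #|setX [set: K * K] (setX W [set: L])|).
  apply: subset_leq_card; apply/subsetP => -[[x s] [w a]].
  by rewrite !inE /= => /andP[_ ->].
by rewrite !cardsX !cardsT card_prod mulnn mulnA.
Qed.

Lemma ruled_setP (p : full_group) : p \in ruled_set ->
  (exists x s w a, [/\ p = curved ((x, s), (w, a)), x != 0 & w \in W]) \/
  (exists s y w v, [/\ p = floor_in (s, ((y, w), v)), (s, ((y, w), v)) \in floor & v != 0]).
Proof.
rewrite inE => /orP[] /imsetP.
  by case=> -[[x s] [w a]]; rewrite inE /= => /andP[x_neq0 wW] ->; left; exists x, s, w, a.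
case=> -[s [[y w] v]] pS ->; right; exists s, y, w, v; split=> //; exact: floor_v pS.
Qed.

(** X1 X3 (a1 - a3)^2 is the variance (X1 + X3) (X1 a1^2 + X3 a3^2) - (X1 a1 + X3 a3)^2, and
the right-hand sides have variance 0. *)
Lemma weighted_variance (X1 X2 X3 a1 a2 a3 : L) : X1 != 0 -> X2 != 0 -> X3 != 0 ->
    X1 + X3 = X2 + X2 -> X1 * a1 + X3 * a3 = X2 * a2 + X2 * a2 ->
    X1 * (a1 * a1) + X3 * (a3 * a3) = X2 * (a2 * a2) + X2 * (a2 * a2) ->
  a1 = a2 /\ a3 = a2.
Proof.
move=> X1_neq0 X2_neq0 X3_neq0 e0 e1 e2.
have : X1 * X3 * ((a1 - a3) * (a1 - a3)) = 0.
  have -> : X1 * X3 * ((a1 - a3) * (a1 - a3)) =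
     (X1 + X3) * (X1 * (a1 * a1) + X3 * (a3 * a3))
     - (X1 * a1 + X3 * a3) * (X1 * a1 + X3 * a3) by ring.
  by rewrite e0 e1 e2; ring.
move/eqP; rewrite !mulf_eq0 (negPf X1_neq0) (negPf X3_neq0) /= orbb subr_eq0 => /eqP a13.
suff a32 : a3 = a2 by rewrite a13 a32.
apply: (mulfI X2_neq0); apply: (mulfI twoL).
have -> : 2 * (X2 * a3) = (X2 + X2) * a3 by ring.
by rewrite -e0 mulrDl -{1}a13 e1 mulrDl mul1r.
Qed.

Lemma coordinates (p1 p2 p3 : full_group) : p1 + p3 = p2 + p2 ->
  [/\ p1.1.1 + p3.1.1 = p2.1.1 + p2.1.1, p1.1.2 + p3.1.2 = p2.1.2 + p2.1.2,
      p1.2.1.1 + p3.2.1.1 = p2.2.1.1 + p2.2.1.1, p1.2.1.2 + p3.2.1.2 = p2.2.1.2 + p2.2.1.2 &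
      p1.2.2.1 + p3.2.2.1 = p2.2.2.1 + p2.2.2.1 /\ p1.2.2.2 + p3.2.2.2 = p2.2.2.2 + p2.2.2.2].
Proof.
move: p1 p2 p3 => [[x1 s1] [[y1 w1] [u1 v1]]] [[x2 s2] [[y2 w2] [u2 v2]]].
by move=> [[x3 s3] [[y3 w3] [u3 v3]]] [].
Qed.

Lemma no2F (q : floor_group) : q + q = 0 -> q = 0.
Proof.
by case: q => s [[y w] v] [/field_no2-> // /field_no2-> // /no2Phi-> /field_no2->].
Qed.

(** Three points with x <> 0 are handled by weighted_variance, height_midpoint and W.  If
exactly one point is on the floor, the other two share the same a, and v = 0
at the third, which the floor set avoids.  If two are on the floor, so is the third. *)
Lemma ruled_set_free : AP3_free ruled_set.
Proof.
have [/AP3_freeP freeW _] := elimT (complete_AP3_freeP no2Phi W) complW.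
have neq0 (x : K) : x != 0 -> iota x != 0 by rewrite fmorph_eq0.
apply/AP3_freeP => p1 p2 p3.
case/ruled_setP=> [[x1 [s1 [w1 [a1 [-> /neq0 X1 w1W]]]]]|[s1 [y1 [w1 [v1 [-> p1S v1_neq0]]]]]];
case/ruled_setP=> [[x2 [s2 [w2 [a2 [-> /neq0 X2 w2W]]]]]|[s2 [y2 [w2 [v2 [-> p2S v2_neq0]]]]]];
case/ruled_setP=> [[x3 [s3 [w3 [a3 [-> /neq0 X3 w3W]]]]]|[s3 [y3 [w3 [v3 [-> p3S v3_neq0]]]]]];
case/coordinates=> /=; rewrite ?rmorph0 ?addr0 ?add0r => ex es ey ew [eu ev].
all: move: (congr1 iota ex); rewrite ?rmorphD => eX.
- have [a12 a32] := weighted_variance X1 X2 X3 eX eu ev.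
  rewrite (freeW w1 w2 w3) // {w1 w1W ew}; rewrite a12 a32 in ey *.
  have [|-> -> //] := height_midpoint nsqK ex es.
  by apply: (@addIr _ (omega a2 + omega a2)); rewrite addrACA ey addrACA.
- have a12 : a1 = a2 by apply: (mulfI X1); rewrite eu -mulrDl -eX.
  case/eqP: v3_neq0; move: ev; rewrite -mulrDl -eX a12 => /eqP.
  by rewrite -subr_eq0 addrAC subrr add0r => /eqP.
- have X31 : iota x3 = - iota x1.
    by apply/eqP; rewrite -addr_eq0 addrC eX rmorph0.
  have a13 : a1 = a3.
    by apply: (mulfI X1); apply/eqP; rewrite -subr_eq0 -mulNr -X31 eu.
  by case/eqP: v2_neq0; apply: (field_no2 twoL); rewrite -ev X31 a13 mulNr subrr.
- by case/eqP: X1; rewrite eX rmorph0.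
- have a32 : a3 = a2 by apply: (mulfI X3); rewrite eu -mulrDl -eX.
  case/eqP: v1_neq0; move: ev; rewrite -mulrDl -eX a32 => /eqP.
  by rewrite -subr_eq0 addrK => /eqP.
- by case/eqP: X2; apply: (field_no2 twoL); rewrite -eX rmorph0.
- by case/eqP: X3; rewrite eX rmorph0.
- have [/AP3_freeP freeFloor _] := elimT (complete_AP3_freeP no2F floor) complFloor.
  have -> : (s1, (y1, w1, v1)) = (s3, (y3, w3, v3)); last by [].
  apply: (freeFloor _ _ _ p1S p2S p3S).
  by rewrite !prodZ_addE es ey ew ev.
Qed.

(** The kind b of the combination is dictated by W; all the other coordinates can
follow either kind. *)
Lemma ruled_set_spans : spans ruled_set.
Proof.
have [_ spanW] := elimT (complete_AP3_freeP no2Phi W) complW.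
have [_ spanFloor] := elimT (complete_AP3_freeP no2F floor) complFloor.
move=> [[x s] [[y w] [u v]]].
have [xuv | ] := boolP ((x != 0) || (u != 0) || (v == 0)).
  have [b [w1 [w2 [w1W w2W cw]]]] := spanW w.
  have [g1 [g2 [s1 [s2 [a1 [a2 [[g1_neq0 g2_neq0 Ex Eu Ev] Es Ey]]]]]]] := reach b s y xuv.
  exists b, (curved ((g1, s1), (w1, a1))), (curved ((g2, s2), (w2, a2))); split.
  - by rewrite inE imset_f ?inE ?g1_neq0.
  - by rewrite inE imset_f ?inE ?g2_neq0.
  rewrite /curved !combines_prodZ cw !combinesE // Ex Es Ey !(iota_weight iota) !mulrA -!rmorphM.
  by rewrite -!mulrA Eu Ev !eqxx.
rewrite !negb_or !negbK => /andP[/andP[/eqP-> /eqP->] _].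
have [b [[s1 [[y1 w1] v1]] [[s2 [[y2 w2] v2]] [p1S p2S]]]] := spanFloor (s, ((y, w), v)).
rewrite !combines_prodZ => /and3P[cs /andP[cy cw] cv].
exists b, (floor_in (s1, ((y1, w1), v1))), (floor_in (s2, ((y2, w2), v2))).
split; rewrite ?inE ?(imset_f floor_in) ?orbT //.
by rewrite /floor_in !combines_prodZ /= cs cy cw cv !combinesxx.
Qed.

End Construction.

(** * Paraboloids *)

Lemma rV_exponent p n : prime p -> forall x : 'rV['F_p]_n, x *+ p = 0.
Proof.
move=> pr_p x; apply/matrixP => i j; rewrite mulmxnE mxE -mulr_natr.
by rewrite (pcharf0 (pchar_Fp pr_p)) mulr0.
Qed.

Lemma card_rV p n : prime p -> #|{: 'rV['F_p]_n}| = (p ^ n)%N.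
Proof. by move=> pr_p; rewrite card_mx mul1n card_Fp. Qed.

Lemma exponent_two_neq0 p (F : fieldType) : odd p -> (forall x : F, x *+ p = 0) -> 2 != 0 :> F.
Proof.
move=> p_odd expF; apply: contraTneq (oner_neq0 F) => two0; rewrite negbK.
by rewrite -(expF 1) -(odd_double_half p) p_odd mulrnDr -mul2n mulrnA two0 mul0rn addr0.
Qed.

Lemma prodZ_mulrn (A B : finZmodType) (a : A) (b : B) n :
  ((a, b) : prodZ A B) *+ n = (a *+ n, b *+ n).
Proof. by elim: n => [|n IHn] //; rewrite !mulrS IHn. Qed.

Section Paraboloid.

Variables (F : finFieldType) (eta : F) (Phi : finZmodType) (W : {set Phi}).
Hypotheses (two_neq0 : 2 != 0 :> F) (nsq_eta : nonsquare eta) (F_gt4 : (4 < #|F|)%N).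
Hypothesis no2Phi : forall w : Phi, w + w = 0 -> w = 0.

Definition on_paraboloid (q : (F * F) * Phi) : prodZ (prodZ F F) (prodZ F Phi) :=
  (q.1, (height eta q.1.1 q.1.2, q.2)).

(** The paraboloid y = height x s has both properties needed to combine it with an arbitrary W:
it is 3-AP-free as the form is anisotropic, and since the form represents every value,
each point off it is obtained from it by each of the two kinds of combination. *)
Lemma complete_paraboloid : complete_AP3_free W ->
  complete_AP3_free (on_paraboloid @: setX [set: F * F] W).
Proof.
case/(complete_AP3_freeP no2Phi) => /AP3_freeP freeW spanW.
apply/complete_AP3_freeP.
  by case=> [[x s] [y w]] [/field_no2-> // /field_no2-> // /field_no2-> // /no2Phi->].
split.
  apply/AP3_freeP => _ _ p3 /imsetP[[[x1 s1] w1] w1W ->] /imsetP[[[x2 s2] w2] w2W ->].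
  case/imsetP=> [[[x3 s3] w3] w3W ->]; rewrite /on_paraboloid /= !prodZ_addE => -[ex es ey ew].
  rewrite !in_setX !in_setT /= in w1W w2W w3W.
  rewrite (freeW w1 w2 w3) //.
  by have [-> ->] := height_midpoint nsq_eta ex es ey.
move=> [[x s] [y w]]; have [b [w1 [w2 [w1W w2W cw]]]] := spanW w.
have [l1_neq0 l2_neq0 l12] := weights two_neq0 b.
set l1 := weight1 F b in l1_neq0 l12; set l2 := weight2 F b in l2_neq0 l12.
have El2 : l2 = 1 - l1 by rewrite -l12 addrC addKr.
have [t1 [t2 Et]] : exists t1 t2, y - height eta x s = (t1 * t1 - eta * (t2 * t2)) * (l1 * l2).
  have [D0 | D_neq0] := eqVneq (y - height eta x s) 0.
    by exists 0, 0; rewrite D0 !mulr0 subrr mul0r.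
  have [|t1 [t2 [Et _ _]]] :=
    @conic_avoid F eta ((y - height eta x s) / (l1 * l2)) 0 0 two_neq0 F_gt4 nsq_eta.
    by rewrite mulf_neq0 // invr_eq0 mulf_neq0.
  by exists t1, t2; rewrite Et mulfVK // mulf_neq0.
exists b, (on_paraboloid ((x + l2 * t1, s + l2 * t2), w1)).
exists (on_paraboloid ((x - l1 * t1, s - l1 * t2), w2)); split.
- by rewrite imset_f // in_setX in_setT.
- by rewrite imset_f // in_setX in_setT.
rewrite /on_paraboloid !combines_prodZ cw !combinesE //= -/l1 -/l2 andbT.
apply/andP; split; first by apply/andP; split; rewrite El2; apply/eqP; ring.
have -> : y = (t1 * t1 - eta * (t2 * t2)) * (l1 * l2) + height eta x s by rewrite -Et subrK.
by rewrite /height El2; apply/eqP; ring.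
Qed.

End Paraboloid.

Lemma a_3AP_le_card (G : finZmodType) : (a_3AP G <= #|G|)%N.
Proof. by have [S _ <-] := a_3AP_witness G; apply: max_card. Qed.

(** The paraboloid over the field with p^(d / 3) elements, times a complete set of the
remaining dimension d mod 3. *)
Lemma small_complete_set p d : prime p -> odd p -> (6 <= d)%N ->
  exists2 S : {set 'rV['F_p]_d}, complete_AP3_free S & (#|S| <= p ^ (2 * (d %/ 3) + d %% 3))%N.
Proof.
move=> pr_p p_odd d_ge6; have i_ge2 : (1 < d %/ 3)%N by rewrite leq_divRL.
set i := (d %/ 3)%N; set j := (d %% 3)%N.
have [F pcharF cardF] := pPrimePowerField pr_p (ltnW i_ge2 : 0 < d %/ 3)%N.
have expF (x : F) : x *+ p = 0 by rewrite -mulr_natr (pcharf0 pcharF) mulr0.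
have two_neq0 : 2 != 0 :> F by apply: exponent_two_neq0 expF.
have [eta nsq_eta] := nonsquare_exists two_neq0.
have F_gt4 : (4 < #|F|)%N.
  have p_gt2 := odd_prime_gt2 p_odd pr_p.
  rewrite cardF; apply: (@leq_trans (3 ^ 2)%N) => //.
  by apply: (@leq_trans (p ^ 2)%N); [rewrite leq_exp2r | rewrite leq_exp2l // prime_gt1].
have expPhi := @rV_exponent p j pr_p.
have [W complW cardW] := a_3AP_witness 'rV['F_p]_j.
have complP := complete_paraboloid two_neq0 nsq_eta F_gt4 (odd_exponent_no2 p_odd expPhi) complW.
have expP (q : prodZ (prodZ F F) (prodZ F 'rV['F_p]_j)) : q *+ p = 0.
  by case: q => [[x s] [y w]]; rewrite !prodZ_mulrn !expF expPhi.
have [|T complT cardT] :=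
  complete_AP3_free_elementary pr_p p_odd expP (@rV_exponent p d pr_p) _ complP.
  rewrite card_rV // [LHS]card_prod card_prod card_prod card_rV // cardF -!expnD; congr (_ ^ _)%N.
  rewrite [RHS](divn_eq d 3) /i /j; lia.
exists T => //; rewrite cardT; apply: leq_trans (leq_imset_card _ _) _.
rewrite cardsX cardsT card_prod cardF cardW expnD mulnC [(2 * i)%N]mulnC expnM -mulnn mulnC.
by rewrite leq_mul2l -(card_rV j pr_p) a_3AP_le_card orbT.
Qed.

(** * From dimension j to dimension n *)

(** A complete set with fewer than |L| elements misses some value v0 of the last coordinate;
translating by - v0 makes it miss 0. *)
Lemma avoiding_floor_set p (K L : finFieldType) (Phi : finZmodType) :
    prime p -> odd p ->
    (forall x : floor_group K L Phi, x *+ p = 0) ->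
  forall d, #|floor_group K L Phi| = (p ^ d)%N -> (6 <= d)%N ->
    (p ^ (2 * (d %/ 3) + d %% 3) < #|L|)%N ->
  exists S : {set floor_group K L Phi}, [/\ complete_AP3_free S, (#|S| <= #|L|)%N
    & forall s y w v, (s, ((y, w), v)) \in S -> v != 0].
Proof.
move=> pr_p p_odd expG d cardG d_ge6 d_small.
have [T0 complT0 cardT0] := small_complete_set pr_p p_odd d_ge6.
have [|T complT cardT] :=
  complete_AP3_free_elementary pr_p p_odd (@rV_exponent p d pr_p) expG _ complT0.
  by rewrite card_rV // cardG.
have ltTL : (#|T| < #|L|)%N by rewrite cardT; apply: leq_ltn_trans cardT0 d_small.
have : ~~ ([set: L] \subset [set x.2.2 | x : floor_group K L Phi in T]).
  apply/negP => /subset_leq_card; rewrite cardsT leqNgt => /negP; apply.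
  exact: leq_ltn_trans (leq_imset_card _ _) ltTL.
case/subsetPn=> v0 _ v0NT.
pose t : floor_group K L Phi := (0, ((0, 0), - v0)).
exists [set x + t | x in T]; split.
- by apply: complete_AP3_free_translate (odd_exponent_no2 p_odd expG) complT.
- by apply: leq_trans (leq_imset_card _ _) (ltnW ltTL).
move=> s y w v /imsetP[[s' [[y' w'] v']] xT [_ _ _ ->]].
rewrite subr_eq0; apply: contraNneq v0NT => <-.
by apply/imsetP; exists (s', ((y', w'), v')).
Qed.

Lemma exp_lt_exp2_half p n q : (0 < n)%N -> (2 * p * n + 7 <= q)%N ->
  (2 * p ^ n < 2 ^ ((q - 3)./2))%N.
Proof.
move=> n_gt0 le_q; have le_pn : (p ^ n <= 2 ^ (p * n))%N.
  by rewrite expnM leq_exp2r // ltnW // ltn_expl.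
apply: leq_ltn_trans (leq_mul (leqnn 2) le_pn) _.
rewrite -expnS ltn_exp2l //.
move: le_q; rewrite -mulnA; set m := (p * n)%N; lia.
Qed.

(** The ruled set for |K| = p^r and [L : K] = 2 c + 1.  With
k = [L : K], the group K^3 * L^2 has dimension r (2 k + 3) = r (4 c + 5).  The bound on
c makes the floor group small enough, 2/3 of its dimension being less than that of L, and the bound on
p^r pays for the union bound. *)
Lemma a_3AP_step p r c j n : prime p -> odd p -> (0 < r)%N -> (6 <= c)%N -> (j < 4 * r)%N ->
    n = (r * (4 * c + 5) + j)%N -> (2 * p * n + 7 <= p ^ r)%N ->
  (a_3AP 'rV['F_p]_n ^ 2 * p ^ j <= 4 * p ^ r * a_3AP 'rV['F_p]_j ^ 2 * p ^ n)%N.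
Proof.
move=> pr_p p_odd r_gt0 c_ge6 j_lt En q_ge.
pose k := (2 * c).+1.
have [K [L [iota [cardK cardL expK expL]]]] := finite_field_tower pr_p r_gt0 (ltn0Sn (2 * c)).
rewrite -/k in cardL.
have twoK : 2 != 0 :> K by apply: exponent_two_neq0 expK.
have twoL : 2 != 0 :> L by apply: exponent_two_neq0 expL.
have [eta nsqK] := nonsquare_exists twoK.
have nsqL : nonsquare (iota eta).
  apply: (@nonsquare_odd_extension K L iota k) => //; rewrite ?cardL ?cardK ?expnM //.
    by rewrite oddX p_odd orbT.
  by rewrite /k /= mul2n odd_double.
have n_gt0 : (0 < n)%N by rewrite En addn_gt0 muln_gt0 r_gt0 addn_gt0 orbT.
have K_gt4 : (4 < #|K|)%N by rewrite cardK; apply: leq_trans q_ge; rewrite addnC.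
have cardKL : (#|K| ^ 3 * #|L| ^ 2 * p ^ j = p ^ n)%N.
  by rewrite cardK cardL -!expnM -!expnD; congr (p ^ _)%N; rewrite En /k; lia.
have p_gt0 := prime_gt0 pr_p.
have few : (2 * (#|K| ^ 3 * #|L| ^ 2) < 2 ^ ((#|K| - 3)./2))%N.
  rewrite cardK; apply: leq_ltn_trans (exp_lt_exp2_half n_gt0 q_ge).
  by rewrite leq_mul2l -cardKL cardK leq_pmulr // expn_gt0 p_gt0.
have [omega reach0] := reaching_heights twoK twoL nsqK nsqL few.
have reach := reach_all twoK twoL nsqK nsqL K_gt4 reach0.
have expPhi := @rV_exponent p j pr_p.
have no2Phi := odd_exponent_no2 p_odd expPhi.
have [W complW cardW] := a_3AP_witness 'rV['F_p]_j.
have expFl (q : floor_group K L 'rV['F_p]_j) : q *+ p = 0.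
  by case: q => s [[y w] v]; rewrite !prodZ_mulrn expK expK expPhi expL.
have expFu (q : full_group K L 'rV['F_p]_j) : q *+ p = 0.
  by case: q => [[x s] [[y w] [u v]]]; rewrite !prodZ_mulrn !expK expPhi !expL.
pose d := (r + (r + j + r * k))%N.
have [||| floor [complFloor cardFloor floor_v]] := avoiding_floor_set pr_p p_odd expFl (d := d).
- by rewrite [LHS]card_prod !card_prod card_rV // cardK cardL -!expnD.
- by rewrite /d /k; lia.
- rewrite cardL ltn_exp2l ?prime_gt1 //.
  have : (2 * d + 2 < 3 * (r * k))%N.
    have : (r * 13 <= r * k)%N by rewrite leq_mul2l /k; apply/orP; right; lia.
    by rewrite /d; move: j_lt r_gt0; lia.
  by have := divn_eq d 3; have := ltn_pmod d (isT : 0 < 3)%N; lia.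
have complB : complete_AP3_free (ruled_set iota eta omega W floor).
  apply/(complete_AP3_freeP (odd_exponent_no2 p_odd expFu)); split.
    exact: ruled_set_free.
  exact: ruled_set_spans.
have [|T complT cardT] :=
  complete_AP3_free_elementary pr_p p_odd expFu (@rV_exponent p n pr_p) _ complB.
  rewrite card_rV // -cardKL [LHS]card_prod !card_prod card_rV //.
  rewrite cardK cardL -!expnD -!expnM -!expnD; congr (p ^ _)%N. lia.
have W_gt0 : (0 < #|W|)%N.
  have [_ /(_ 0)[b [w [_ [wW _ _]]]]] := elimT (complete_AP3_freeP no2Phi W) complW.
  by apply/card_gt0P; exists w.
have le_a : (a_3AP 'rV['F_p]_n <= 2 * (#|K| ^ 2 * #|W| * #|L|))%N.
  apply: leq_trans (a_3AP_le complT) _; rewrite cardT.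
  apply: leq_trans (card_ruled_set _ _ _ _ _) _.
  rewrite mul2n -addnn leq_add2l; apply: leq_trans cardFloor _.
  by rewrite leq_pmull // muln_gt0 W_gt0 expn_gt0 (ltn_trans _ K_gt4).
rewrite -cardW.
have : (a_3AP 'rV['F_p]_n ^ 2 <= (2 * (#|K| ^ 2 * #|W| * #|L|)) ^ 2)%N by rewrite leq_exp2r.
move/(leq_mul (leqnn (p ^ j)))=> le_a2; rewrite mulnC; apply: leq_trans le_a2 _.
rewrite -cardKL -cardK !expnMn; apply: eq_leq.
by rewrite !expnS !expn0 !muln1; ring.
Qed.

Section Bounds.

Local Open Scope nat_scope.

(** The dimension r of K over the prime field must satisfy 29 r <= n, so that n - 5 r, divided
by 4 r, has quotient at least 6. *)
Lemma up_log_le p n : 2 < p -> 203 <= n -> 29 * up_log p (2 * p * n + 7) <= n.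
Proof.
move=> p_gt2 n_ge; have p_gt1 := ltnW p_gt2; rewrite mulnC -leq_divRL // up_log_min //.
set y := n %/ 29; have y_ge7 : 7 <= y by rewrite leq_divRL.
have n_lt : n < 29 * y.+1 by rewrite mulnC ltn_ceil.
have pow3 : 65 * y.+1 <= 3 ^ y.-1.
  have pow m : 65 * (m + 8) <= 3 ^ (m + 6).
    by elim: m => // m IHm; rewrite !addSn expnS; lia.
  have [e8 e6] : y - 7 + 8 = y.+1 /\ y - 7 + 6 = y.-1 by lia.
  by have := pow (y - 7); rewrite e8 e6.
apply: (@leq_trans (p * (65 * y.+1))).
  apply: (@leq_trans (p * (2 * n + 7))).
    by rewrite mulnDr mulnA [2 * p]mulnC leq_add2l leq_pmull // ltnW.
  by rewrite leq_mul2l; apply/orP; right; lia.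
have -> : p ^ y = p * p ^ y.-1 by rewrite -expnS prednK // (leq_trans _ y_ge7).
rewrite leq_mul2l; apply/orP; right; apply: leq_trans pow3 _.
by rewrite leq_exp2r // -ltnS prednK // (leq_trans _ y_ge7).
Qed.

(** r is the least exponent with p^r >= 2 p n + 7, and n - 5 r is divided by 4 r. *)
Lemma a_3AP_pass p n : prime p -> odd p -> 203 <= n ->
  exists r j, [/\ 0 < r, j < 4 * r, p ^ r <= 9 * p ^ 2 * n
    & (a_3AP 'rV['F_p]_n ^ 2 * p ^ j <= 4 * p ^ r * a_3AP 'rV['F_p]_j ^ 2 * p ^ n)].
Proof.
move=> pr_p p_odd n_ge; have p_gt1 := prime_gt1 pr_p; have p_gt2 := odd_prime_gt2 p_odd pr_p.
pose r := up_log p (2 * p * n + 7).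
have r_small : 29 * r <= n by apply: up_log_le.
have big : 2 * p * n + 7 <= p ^ r by apply: up_logP.
have r_gt0 : 0 < r by rewrite up_log_gt0 p_gt1 /= !addnS.
exists r, ((n - 5 * r) %% (4 * r)); split=> //; first by rewrite ltn_mod muln_gt0 /= r_gt0.
  have : p ^ r.-1 < 2 * p * n + 7 by apply: up_log_gtn => //; rewrite !addnS.
  move=> lt_q; apply: (@leq_trans (p * (2 * p * n + 7))).
    by rewrite -(prednK r_gt0) expnS leq_mul2l ltnW ?orbT.
  have : 7 <= 7 * p * n by rewrite -mulnA leq_pmulr // muln_gt0 (ltnW p_gt1) (leq_trans _ n_ge).
  by rewrite expnS expn1; nia.
apply: (@a_3AP_step p r ((n - 5 * r) %/ (4 * r))) => //.
- by rewrite leq_divRL ?muln_gt0 //; lia.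
- by rewrite ltn_mod muln_gt0 /= r_gt0.
- have := divn_eq (n - 5 * r) (4 * r); set c := _ %/ _; set j := _ %% _ => Ec.
  have -> : n = (n - 5 * r) + 5 * r by rewrite subnK //; lia.
  by rewrite Ec; lia.
Qed.

Lemma pow5_le p r : 1 < p -> r ^ 5 <= 3125 * p ^ r.
Proof.
move=> p_gt1; have r_le : r <= 5 * 2 ^ (r %/ 5).
  have := ltn_expl (r %/ 5) (isT : 1 < 2); have := divn_eq r 5.
  by have := ltn_pmod r (isT : 0 < 5); lia.
apply: (@leq_trans ((5 * 2 ^ (r %/ 5)) ^ 5)); first by rewrite leq_exp2r.
rewrite expnMn -expnM leq_mul2l /=; apply: (@leq_trans (2 ^ r)).
  by rewrite leq_exp2l // leq_trunc_div.
have [-> // | r_gt0] := posnP r.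
by rewrite leq_exp2r.
Qed.

Lemma a_3AP_le_exp p n : prime p -> a_3AP 'rV['F_p]_n <= p ^ n.
Proof. by move=> pr_p; rewrite -card_rV // a_3AP_le_card. Qed.

Lemma a_3AP_small p n m : prime p -> n <= m -> a_3AP 'rV['F_p]_n ^ 2 <= p ^ m * p ^ n.
Proof.
move=> pr_p le_nm; rewrite -mulnn leq_mul ?a_3AP_le_exp //.
by apply: leq_trans (a_3AP_le_exp n pr_p) _; rewrite leq_exp2l ?prime_gt1.
Qed.

(** First pass: a(j) <= p^j with j < 4 r costs a factor p^(4 r), polynomial in n. *)
Lemma a_3AP_crude p : prime p -> odd p ->
  exists C, forall n, a_3AP 'rV['F_p]_n ^ 2 <= C * n.+1 ^ 5 * p ^ n.
Proof.
move=> pr_p p_odd; have p_gt0 := prime_gt0 pr_p.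
exists (p ^ 203 + 4 * (9 * p ^ 2) ^ 5) => n.
have [n_lt | n_ge] := ltnP n 203.
  apply: leq_trans (a_3AP_small pr_p (ltnW n_lt)) _; rewrite leq_mul2r; apply/orP; right.
  by rewrite -[leqLHS]muln1 leq_mul ?leq_addr ?expn_gt0.
have [r [j [r_gt0 j_lt q_le]]] := a_3AP_pass pr_p p_odd n_ge.
have := a_3AP_le_exp j pr_p; set a := a_3AP _; set b := a_3AP _ => b_le step.
have pj_gt0 : 0 < p ^ j by rewrite expn_gt0 p_gt0.
rewrite -(leq_pmul2r pj_gt0); apply: leq_trans step _; rewrite [leqRHS]mulnAC.
rewrite leq_mul2r; apply/orP; right.
apply: (@leq_trans (4 * p ^ r * (p ^ j * p ^ j))).
  by rewrite leq_mul2l -mulnn leq_mul ?orbT.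
rewrite mulnA leq_mul2r; apply/orP; right.
apply: (@leq_trans (4 * (p ^ r) ^ 5)).
  rewrite -mulnA leq_mul2l -expnD -expnM leq_exp2l ?prime_gt1 //=; lia.
rewrite mulnDl; apply: leq_trans (leq_addl _ _); rewrite -mulnA leq_mul2l -expnMn leq_exp2r //=.
by apply: leq_trans q_le _; rewrite leq_mul2l leqnSn orbT.
Qed.

(** Second pass: the crude bound for a(j) costs only (j+1)^5 <= (4 r)^5, which is absorbed by
one more factor p^r = O(n). *)
Lemma a_3AP_upper p : prime p -> odd p ->
  exists C, forall n, 0 < n -> a_3AP 'rV['F_p]_n ^ 2 <= C * n ^ 2 * p ^ n.
Proof.
move=> pr_p p_odd; have p_gt0 := prime_gt0 pr_p.
have [C0 crude] := a_3AP_crude pr_p p_odd.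
exists (p ^ 203 + 4 * C0 * 4 ^ 5 * 3125 * (9 * p ^ 2) ^ 2) => n n_gt0.
have [n_lt | n_ge] := ltnP n 203.
  apply: leq_trans (a_3AP_small pr_p (ltnW n_lt)) _; rewrite leq_mul2r; apply/orP; right.
  by rewrite -[leqLHS]muln1 leq_mul ?leq_addr ?expn_gt0 ?n_gt0.
have [r [j [r_gt0 j_lt q_le]]] := a_3AP_pass pr_p p_odd n_ge.
have := crude j; set a := a_3AP _; set b := a_3AP _ => b_le step.
have pj_gt0 : 0 < p ^ j by rewrite expn_gt0 p_gt0.
rewrite -(leq_pmul2r pj_gt0); apply: leq_trans step _; rewrite [leqRHS]mulnAC.
rewrite leq_mul2r; apply/orP; right.
apply: (@leq_trans (4 * p ^ r * (C0 * j.+1 ^ 5 * p ^ j))); first by rewrite leq_mul2l b_le orbT.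
rewrite mulnA leq_mul2r; apply/orP; right.
apply: (@leq_trans (4 * p ^ r * (C0 * (4 ^ 5 * (3125 * p ^ r))))).
  rewrite !leq_mul2l; apply/orP; right; apply/orP; right.
  apply: (@leq_trans ((4 * r) ^ 5)); first by rewrite leq_exp2r.
  by rewrite expnMn leq_mul2l pow5_le ?prime_gt1 ?orbT.
rewrite mulnDl; apply: leq_trans (leq_addl _ _).
have -> : 4 * p ^ r * (C0 * (4 ^ 5 * (3125 * p ^ r))) = 4 * C0 * 4 ^ 5 * 3125 * (p ^ r) ^ 2.
  by rewrite -mulnn; ring.
by rewrite -[leqRHS]mulnA leq_mul2l -expnMn leq_exp2r ?q_le ?orbT.
Qed.

Lemma a_3AP_lower p n : prime p -> odd p -> p ^ n <= 2 * a_3AP 'rV['F_p]_n ^ 2.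
Proof.
move=> pr_p p_odd; have no2 := odd_exponent_no2 p_odd (@rV_exponent p n pr_p).
have [S /(complete_AP3_freeP no2)[_ spanS] <-] := a_3AP_witness 'rV['F_p]_n.
by rewrite -card_rV //; apply: card_le_spans no2 _ spanS.
Qed.

End Bounds.

(** * Growth rate *)

From mathcomp Require Import all_classical all_reals all_analysis.
Import Order.TTheory GRing.Theory Num.Theory.
Import numFieldNormedType.Exports.
Local Open Scope classical_set_scope.
Local Open Scope ring_scope.

(** With e n := ln (a n) / ln p - n / 2, both bounds give |e n| = O(1 + ln n), which is
majorized by a multiple of sqrt n. *)
Lemma growth_of_sequence (R : realType) (p : nat) (a : nat -> nat) (C0 : nat) :
    (1 < p)%N ->
    (forall n, (0 < n)%N -> (a n ^ 2 <= C0 * n ^ 2 * p ^ n)%N) ->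
    (forall n, (p ^ n <= 2 * a n ^ 2)%N) ->
  (forall eps : R, 0 < eps -> exists C : R, forall n : nat, (1 <= n)%N ->
     (a n)%:R <= C * n%:R `^ (1 + eps) * p%:R `^ (n%:R / 2)) /\
  (exists e : nat -> R, e =o_\oo (fun n : nat => n%:R : R) /\
     forall n : nat, (1 <= n)%N -> (a n)%:R = p%:R `^ (n%:R / 2 + e n)).
Proof.
move=> p_gt1N upper lower.
have p_gt1 : 1 < p%:R :> R by rewrite ltr1n.
have p_gt0 : 0 < p%:R :> R by apply: lt_trans p_gt1.
have lnp_gt0 : 0 < ln p%:R :> R by apply: ln_gt0.
pose C := C0.+1.
have {}upper n : (0 < n)%N -> (a n)%:R ^+ 2 <= C%:R * n%:R ^+ 2 * p%:R ^+ n :> R.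
  move=> n_gt0; rewrite -!natrX -!natrM ler_nat; apply: leq_trans (upper n n_gt0) _.
  by rewrite !leq_mul2r leqnSn !orbT.
have {}lower n : p%:R ^+ n <= 2 * (a n)%:R ^+ 2 :> R.
  by rewrite -!natrX -natrM ler_nat lower.
have C_ge1 : 1 <= C%:R :> R by rewrite ler1n.
have half_power n : (p%:R `^ (n%:R / 2)) ^+ 2 = p%:R ^+ n :> R.
  by rewrite -powR_mulrn ?powR_ge0 // -powRrM mulfVK ?powR_mulrn // ltW.
split.
  move=> eps eps_gt0; exists C%:R => n n_gt0.
  have n_ge1 : 1 <= n%:R :> R by rewrite ler1n.
  have le_n : n%:R <= n%:R `^ (1 + eps) :> R.
    rewrite -[leLHS]powRr1 ?ler0n // ler_powR //; lra.
  apply: (@le_trans _ _ (C%:R * n%:R * p%:R `^ (n%:R / 2))); last first.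
    by rewrite ler_wpM2r ?powR_ge0 // ler_wpM2l ?ler0n.
  rewrite -(@ler_pXn2r _ 2) ?nnegrE ?mulr_ge0 ?powR_ge0 //.
  rewrite !exprMn half_power; apply: le_trans (upper n n_gt0) _.
  rewrite -!mulrA ler_wpM2l ?ler0n // ler_peMl // !mulr_ge0 ?exprn_ge0 ?ler0n //.
have a_gt0 n : 0 < (a n)%:R :> R.
  rewrite lt0r ler0n andbT; apply: contraTneq (lower n) => ->.
  by rewrite expr0n mulr0 -ltNge exprn_gt0.
pose e n : R := ln (a n)%:R / ln p%:R - n%:R / 2.
exists e; split; last first.
  move=> n _; rewrite /e addrC subrK /powR. rewrite gt_eqF // mulfVK ?gt_eqF //.
  by rewrite lnK // posrE.
have ln2_ge0 : 0 <= ln 2 :> R by rewrite ln_ge0 // ler1n.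
have lnC_ge0 : 0 <= ln C%:R :> R by rewrite ln_ge0.
pose M : R := (ln 2 + ln C%:R + 2) / ln p%:R.
have M_gt0 : 0 < M by rewrite divr_gt0 //; lra.
have e_le n : (0 < n)%N -> `|e n| <= M * Num.sqrt n%:R.
  move=> n_gt0; have n_ge1 : 1 <= n%:R :> R by rewrite ler1n.
  have n_pos : 0 < n%:R :> R by rewrite ltr0n.
  have sq_ge1 : 1 <= Num.sqrt n%:R :> R by rewrite -[leLHS]sqrtr1 ler_wsqrtr.
  have ln_n : ln n%:R <= 2 * Num.sqrt n%:R :> R.
    have s_gt0 : 0 < Num.sqrt n%:R :> R by rewrite sqrtr_gt0.
    have ln_s : ln (Num.sqrt n%:R) <= Num.sqrt n%:R :> R.
      have := @le_ln1Dx R (Num.sqrt n%:R - 1); rewrite [1 + _]addrC subrK => le_s.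
      by apply: le_trans (le_s _) _; lra.
    rewrite -{1}[n%:R]sqr_sqrtr ?ler0n // expr2 lnM ?posrE //; lra.
  have lo : n%:R * ln p%:R <= ln 2 + 2 * ln (a n)%:R :> R.
    have : ln (p%:R ^+ n) <= ln (2 * (a n)%:R ^+ 2) :> R.
      by rewrite ler_ln ?posrE ?exprn_gt0 ?mulr_gt0 ?exprn_gt0.
    rewrite lnXn // lnM ?posrE ?exprn_gt0 // lnXn //.
    by rewrite !mulr_natl.
  have up : 2 * ln (a n)%:R <= ln C%:R + 2 * ln n%:R + n%:R * ln p%:R :> R.
    have C_gt0 : 0 < C%:R :> R by rewrite ltr0n.
    have : ln ((a n)%:R ^+ 2) <= ln (C%:R * n%:R ^+ 2 * p%:R ^+ n) :> R.
      by rewrite ler_ln ?posrE ?exprn_gt0 ?mulr_gt0 ?exprn_gt0 ?upper.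
    by rewrite !lnM ?posrE ?mulr_gt0 ?exprn_gt0 // !lnXn // !mulr_natl.
  have -> : e n = (2 * ln (a n)%:R - n%:R * ln p%:R) / (2 * ln p%:R).
    by rewrite /e; field; rewrite gt_eqF.
  have -> : M * Num.sqrt n%:R = 2 * (ln 2 + ln C%:R + 2) * Num.sqrt n%:R / (2 * ln p%:R).
    by rewrite /M; field; rewrite gt_eqF.
  have s2 : ln 2 <= ln 2 * Num.sqrt n%:R :> R by rewrite ler_peMr.
  have sC : ln C%:R <= ln C%:R * Num.sqrt n%:R :> R by rewrite ler_peMr.
  rewrite ler_norml -mulNr !ler_pM2r ?invr_gt0 ?mulr_gt0 //; apply/andP; split; lra.
apply/eqoP => eps eps_gt0.
near=> n.
have n_gt0 : (0 < n)%N by near: n; exists 1%N.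
apply: le_trans (e_le n n_gt0) _; rewrite ger0_norm ?ler0n //.
have le_n : (M / eps) ^+ 2 <= n%:R by near: n; apply: nbhs_infty_ger.
have le_s : M / eps <= Num.sqrt n%:R.
  rewrite -(@ler_pXn2r _ 2) ?nnegrE ?sqrtr_ge0 // ?sqr_sqrtr ?ler0n //.
  by rewrite ltW // divr_gt0.
rewrite -[X in _ <= _ * X]sqr_sqrtr ?ler0n // expr2 mulrA ler_wpM2r ?sqrtr_ge0 //.
by rewrite mulrC -ler_pdivrMr.
Unshelve. all: by end_near.
Qed.

Theorem theorem1p3 (R : realType) (p : nat) (hp : prime p) (hodd : odd p) :
  (forall eps : R, 0 < eps ->
     exists C : R, forall n : nat, (1 <= n)%N ->
       (a_3AP 'rV['F_p]_n)%:R
         <= C * n%:R `^ (1 + eps) * p%:R `^ (n%:R / 2))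
  /\
  (exists e : nat -> R,
     e =o_\oo (fun n : nat => n%:R : R) /\
     forall n : nat, (1 <= n)%N ->
       (a_3AP 'rV['F_p]_n)%:R = p%:R `^ (n%:R / 2 + e n)).
Proof.
have [C0 upper] := a_3AP_upper hp hodd.
apply: growth_of_sequence (prime_gt1 hp) upper _ => n.
exact: a_3AP_lower.
Qed.
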